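(* Let $N$ be a conflict-free structural conflict net. Then $N$ has exactly one weakly maximal BD-process, i.e. exactly one maximal GR-process up to $\approx_s^\infty$.
   Context: **Multisets.** A multiset over $X$ is a function $A:X\to\mathbb N$; $x\in A$ iff $A(x)>0$; $A\subseteq B$ iff $A(x)\le B(x)$ for all $x$; $(A\cap B)(x)=\min(A(x),B(x))$; $(A+B)(x)=A(x)+B(x)$; $(A-B)(x)=\max(A(x)-B(x),0)$; $(k\cdot A)(x)=k\,A(x)$; $|A|=\sum_{x}A(x)$; $A$ is finite iff $|A|<\infty$; $A\restriction Y$ is the restriction to $Y\subseteq X$. Multisets on different domains are identified if they agree after extension by $0$. A set is identified with the corresponding $0/1$-valued multiset, and $\{t,u\}$ denotes a multiset (so $\{t,t\}$ has cardinality $2$). **Nets.** A net is $N=(S,T,F,M_0)$ with $S,T$ disjoint sets (places, transitions), $F:(S\times T)\cup(T\times S)\to\mathbb N$ (flow relation with arc weights) and $M_0:S\to\mathbb N$ (initial marking), such that for each $t\in T$ the set $\{s\mid F(s,t)>0\}$ is finite and non-empty and $\{s\mid F(t,s)>0\}$ is finite. For $x\in S\cup T$, ${}^\bullet x(y)=F(y,x)$ and $x^\bullet(y)=F(x,y)$ (multisets), extended additively to multisets $X$: ${}^\bullet X=\sum_x X(x)\cdot{}^\bullet x$, $X^\bullet=\sum_x X(x)\cdot x^\bullet$. Markings are elements of $\mathbb N^S$. **Firing.** For a finite non-empty $G\in\mathbb N^T$, $M\xrightarrow{G}M'$ iff ${}^\bullet G\subseteq M$ and $M'=(M-{}^\bullet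 G)+G^\bullet$. For $\sigma=t_1\cdots t_n\in T^*$, $M\xrightarrow{\sigma}M'$ means $M\xrightarrow{\{t_1\}}M_1\cdots\xrightarrow{\{t_n\}}M'$ for some intermediate markings. Omitted $\sigma$ or $M'$ are existentially quantified; $M$ is reachable iff $M_0\xrightarrow{\sigma}M$ for some $\sigma\in T^*$. **Conflict.** A finite non-empty multiset $G\in\mathbb N^T$ is in (semantic) conflict in $M$ iff $M\xrightarrow{G\restriction\{t\}}$ for all $t\in G$ but not $M\xrightarrow{G}$. $N$ is conflict-free iff no finite non-empty $G\in\mathbb N^T$ is in conflict in any reachable marking. $N$ is a structural conflict net iff for all $t,u\in T$: if $M\xrightarrow{\{t,u\}}$ for some reachable $M$, then ${}^\bullet t\cap{}^\bullet u=\emptyset$. **Processes.** A (GR-)process of $N$ is $P=(\mathcal N,\pi)$ where $\mathcal N=(\mathcal S,\mathcal T,\mathcal F,\mathcal M_0)$ is a net such that: every $s\in\mathcal S$ has $|{}^\bullet s|\le1$, $|s^\bullet|\le 1$, and $\mathcal M_0(s)=1$ if ${}^\bullet s=\emptyset$, $\mathcal M_0(s)=0$ otherwise; $\mathcal F$ is acyclic, i.e. $(x,x)\notin\mathcal F^+$ for all $x$, where $\mathcal F^+$ is the transitive closure of $\{(x,y)\mid\mathcal F(x,y)>0\}$; $\{t\mid (t,u)\in\mathcal F^+\}$ is finite for all $u\in\mathcal T$; and $\pi:\mathcal S\cup\mathcal T\to S\cup T$ satisfies $\pi(\mathcal S)\subseteq S$, $\pi(\mathcal T)\subseteq T$, $M_0(s)=|\pi^{-1}(s)\cap\mathcal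 M_0|$ for all $s\in S$, and for all $t\in\mathcal T,s\in S$: $F(s,\pi(t))=|\pi^{-1}(s)\cap{}^\bullet t|$ and $F(\pi(t),s)=|\pi^{-1}(s)\cap t^\bullet|$. $P$ is finite iff $\mathcal T$ is finite. For processes $P=((\mathcal S,\mathcal T,\mathcal F,\mathcal M_0),\pi)$, $P'=((\mathcal S',\mathcal T',\mathcal F',\mathcal M_0'),\pi')$ of the same net, $P'\le P$ ($P'$ is a prefix of $P$, $P$ an extension of $P'$) iff $\mathcal S'\subseteq\mathcal S$, $\mathcal T'\subseteq\mathcal T$, $\mathcal M_0'=\mathcal M_0$, and $\mathcal F',\pi'$ are the restrictions of $\mathcal F,\pi$ to the elements of $\mathcal S'\cup\mathcal T'$. A process is maximal iff it has no proper extension. Processes $(\mathcal N,\pi)$, $(\mathcal N',\pi')$ are isomorphic iff there is a net isomorphism $\phi:\mathcal N\to\mathcal N'$ (bijection on places and on transitions preserving flow and initial marking) with $\pi=\pi'\circ\phi$. **Swapping.** For $p,q\in\mathcal S$ with $(p,q)\notin\mathcal F^+\cup(\mathcal F^+)^{-1}$ and $\pi(p)=\pi(q)$, $\mathrm{swap}(P,p,q)$ is $((\mathcal S,\mathcal T,\mathcal F',\mathcal M_0),\pi)$ with, for $y\in\mathcal T$, $\mathcal F'(p,y)=\mathcal F(q,y)$, $\mathcal F'(q,y)=\mathcal F(p,y)$, and $\mathcal F'=\mathcal F$ otherwise. $P\approx_s Q$ iff $\mathrm{swap}(P,p,q)$ is isomorphic to $Q$ for some such $p,q$; $\approx_s^*$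 is the reflexive transitive closure. For finite $P$, $[P]_s$ is its $\approx_s^*$-class, and $[P']_s\le[P]_s$ iff $P'\approx_s^*Q'\le Q\approx_s^*P$ for some $Q',Q$. For any process $P$, $\mathrm{BD}(P):={\downarrow}\{[P']_s\mid P'\le P,\ P'\text{ finite}\}$, where $\downarrow$ is downward closure under $\le$ among classes of finite processes. $P\approx_s^\infty Q$ iff $\mathrm{BD}(P)=\mathrm{BD}(Q)$. A BD-process is an $\approx_s^\infty$-equivalence class $[P]_\infty$ of processes. $[P]_\infty$ is weakly maximal (a maximal GR-process up to $\approx_s^\infty$) iff some $P'\in[P]_\infty$ is a maximal process. *)

(* Defs.v *)
From mathcomp Require Import all_boot all_order all_classical.
From Stdlib Require Export Relation_Operators.

Set Implicit Arguments.
Unset Strict Implicit.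
Unset Printing Implicit Defensive.

Local Open Scope classical_set_scope.

(** * Multisets *)

Definition mset (X : Type) := X -> nat.

Section Multisets.
Variable X : Type.
Implicit Types (A B : mset X) (Y : set X).

Definition msupp A : set X := [set x | 0 < A x].

Definition msubset A B := forall x, A x <= B x.

Definition mcap A B : mset X := fun x => minn (A x) (B x).

Definition madd A B : mset X := fun x => A x + B x.

Definition msub A B : mset X := fun x => A x - B x.

Definition mset_of Y : mset X := fun x => nat_of_bool (x \in Y).

Definition mrestrict A Y : mset X := fun x => if x \in Y then A x else 0.

(* Multiplicities are natural numbers, so the sum of all of them is finite
   exactly when the support is. *)
Definition mfinite A := finite_set (msupp A).

(* The sum is 0 by convention when [A] is infinite; hence [has_card] rather than
   a bare equation on [mcard] is used below. *)
Definition mcard A : nat := \big[addn/0]_(x \in [set: {classic X}]) A x.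

Definition has_card A (n : nat) := mfinite A /\ mcard A = n.

Definition card_le A (n : nat) := mfinite A /\ mcard A <= n.

End Multisets.

(** * Nets *)

(* Places and transitions are two types, so they are disjoint; the flow function
   F is given by its two components. *)
Record prenet := PreNet {
  place : Type;
  trans : Type;
  flow_st : place -> trans -> nat;
  flow_ts : trans -> place -> nat;
  init : mset place }.

Definition pre_t (N : prenet) (t : trans N) : mset (place N) :=
  fun s => flow_st s t.
Definition post_t (N : prenet) (t : trans N) : mset (place N) :=
  fun s => flow_ts t s.
Definition pre_s (N : prenet) (s : place N) : mset (trans N) :=
  fun t => flow_ts t s.
Definition post_s (N : prenet) (s : place N) : mset (trans N) :=
  fun t => flow_st s t.

Definition is_net (N : prenet) := forall t : trans N,
  [/\ finite_set (msupp (pre_t t)), msupp (pre_t t) !=set0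
    & finite_set (msupp (post_t t))].

Record net := Net {
  net_data :> prenet;
  netP : is_net net_data }.

(** * Firing *)

Section Firing.
Variable N : prenet.
Implicit Types (M : mset (place N)) (G : mset (trans N)).

(* Meaningful for finite [G] only. *)
Definition pre_m G : mset (place N) :=
  fun s => \big[addn/0]_(t \in [set: {classic trans N}]) (G t * pre_t t s).
Definition post_m G : mset (place N) :=
  fun s => \big[addn/0]_(t \in [set: {classic trans N}]) (G t * post_t t s).

Definition fin_nonempty G := mfinite G /\ msupp G !=set0.

Definition fires M G M' :=
  [/\ fin_nonempty G, msubset (pre_m G) M
    & M' = madd (msub M (pre_m G)) (post_m G)].

Definition enabled M G := exists M', fires M G M'.

Fixpoint fires_seq M (sigma : seq (trans N)) M' : Prop :=
  if sigma is t :: sigma' then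
    exists2 M1, fires M (mset_of [set t]) M1 & fires_seq M1 sigma' M'
  else M' = M.

Definition reachable M := exists sigma, fires_seq (@init N) sigma M.

(** * Conflict *)

Definition in_conflict M G :=
  (forall t, msupp G t -> enabled M (mrestrict G [set t])) /\ ~ enabled M G.

Definition conflict_free :=
  forall G M, fin_nonempty G -> reachable M -> ~ in_conflict M G.

Definition structural_conflict_net := forall t u : trans N,
  (exists2 M, reachable M
            & enabled M (madd (mset_of [set t]) (mset_of [set u]))) ->
  msupp (mcap (pre_t t) (pre_t u)) = set0.

End Firing.

(** * Processes *)

Definition node (N : prenet) : Type := (place N + trans N)%type.

Definition arc (N : prenet) (x y : node N) : Prop :=
  match x, y with
  | inl s, inr t => 0 < flow_st s t
  | inr t, inl s => 0 < flow_ts t s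
  | _, _ => False
  end.

Definition flow_plus (N : prenet) : node N -> node N -> Prop :=
  clos_trans (node N) (@arc N).

(* A pair (N', pi) with no condition imposed. *)
Record preprocess (N : prenet) := PreProcess {
  pnet :> prenet;
  pi_s : place pnet -> place N;
  pi_t : trans pnet -> trans N }.

Record is_process (N : prenet) (P : preprocess N) : Prop := IsProcess {
  proc_net : is_net P;
  proc_branching : forall s : place P,
    card_le (pre_s s) 1 /\ card_le (post_s s) 1;
  proc_init : forall s : place P,
    (msupp (pre_s s) = set0 -> init s = 1) /\
    (msupp (pre_s s) <> set0 -> init s = 0);
  proc_acyclic : forall x : node P, ~ flow_plus x x;
  proc_past_finite : forall u : trans P,
    finite_set [set t : trans P | flow_plus (inr t) (inr u)];
  proc_pi_init : forall s : place N,
    has_card (mcap (mset_of (@pi_s N P @^-1` [set s])) (@init P)) (init s);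
  proc_pi_pre : forall (t : trans P) (s : place N),
    has_card (mcap (mset_of (@pi_s N P @^-1` [set s])) (pre_t t))
             (flow_st s (pi_t t));
  proc_pi_post : forall (t : trans P) (s : place N),
    has_card (mcap (mset_of (@pi_s N P @^-1` [set s])) (post_t t))
             (flow_ts (pi_t t) s) }.

Record process (N : prenet) := Process {
  proc_data :> preprocess N;
  processP : is_process proc_data }.

Definition finite_process (N : prenet) (P : process N) :=
  finite_set [set: trans P].

(** * Prefixes *)

(* Inclusion of carriers is rendered by injections [f], [g] along which the flow
   and the labelling of [P] restrict to those of [P'].  The initial markings are
   the same multiset up to extension by 0, hence the condition outside the range
   of [f]. *)
Record inclusion (N : prenet) (P' P : process N)
    (f : place P' -> place P) (g : trans P' -> trans P) : Prop := Inclusion {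
  incl_inj_s : injective f;
  incl_inj_t : injective g;
  incl_init : forall s, init (f s) = init s;
  incl_init0 : forall s, ~ range f s -> init s = 0;
  incl_flow_st : forall s t, flow_st (f s) (g t) = flow_st s t;
  incl_flow_ts : forall t s, flow_ts (g t) (f s) = flow_ts t s;
  incl_pi_s : forall s, pi_s (f s) = pi_s s;
  incl_pi_t : forall t, pi_t (g t) = pi_t t }.

Definition prefix_of (N : prenet) (P' P : process N) :=
  exists f g, @inclusion N P' P f g.

(* Properness is a property of the inclusion: some element of [P] is outside the
   ranges of [f] and [g].  An abstract isomorphism between [P'] and [P] would not
   make a non-surjective inclusion improper. *)
Definition proper_prefix_of (N : prenet) (P' P : process N) :=
  exists f g, @inclusion N P' P f g /\
              ~ (range f = [set: place P] /\ range g = [set: trans P]).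

Definition maximal_process (N : prenet) (P : process N) :=
  ~ exists Q : process N, proper_prefix_of P Q.

(** * Swapping *)

Definition isomorphic (N : prenet) (P Q : preprocess N) :=
  exists (f : place P -> place Q) (g : trans P -> trans Q),
    [/\ bijective f /\ bijective g,
        (forall s t, flow_st (f s) (g t) = flow_st s t),
        (forall t s, flow_ts (g t) (f s) = flow_ts t s),
        (forall s, init (f s) = init s)
      & (forall s, pi_s (f s) = pi_s s) /\ (forall t, pi_t (g t) = pi_t t)].

Definition swappable (N : prenet) (P : preprocess N) (p q : place P) :=
  [/\ ~ flow_plus (inl p : node P) (inl q),
      ~ flow_plus (inl q : node P) (inl p)
    & pi_s p = pi_s q].

Definition swap (N : prenet) (P : preprocess N) (p q : place P) :
    preprocess N :=
  @PreProcess N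
    (@PreNet (place P) (trans P)
       (fun x y => if x \in [set p] then flow_st q y
                   else if x \in [set q] then flow_st p y
                   else flow_st x y)
       (@flow_ts P) (@init P))
    (@pi_s N P) (@pi_t N P).

Definition swap_step (N : prenet) (P Q : process N) :=
  exists p q : place P, swappable p q /\ isomorphic (swap p q) Q.

Definition swap_equiv (N : prenet) : process N -> process N -> Prop :=
  clos_refl_trans (process N) (@swap_step N).

Definition swap_class (N : prenet) (P : process N) : set (process N) :=
  [set Q | swap_equiv P Q].

(** * BD-processes *)

Section BD.
Variable N : prenet.
Implicit Types (P Q : process N) (C D : set (process N)).

Definition class_le C D :=
  exists P' P, [/\ finite_process P', finite_process P,
    C = swap_class P', D = swap_class P
  & exists Q' Q, [/\ swap_equiv P' Q', prefix_of Q' Q & swap_equiv Q P]].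

Definition down (X : set (set (process N))) : set (set (process N)) :=
  [set C | exists2 D, X D & class_le C D].

Definition BD P : set (set (process N)) :=
  down [set swap_class P' | P' in [set P' | prefix_of P' P /\ finite_process P']].

Definition swap_equiv_inf P Q := BD P = BD Q.

Definition inf_class P : set (process N) := [set Q | swap_equiv_inf P Q].

Definition BD_process (B : set (process N)) := exists P, B = inf_class P.

Definition weakly_maximal (B : set (process N)) :=
  exists2 P, B P & maximal_process P.

End BD.

(* Main.v *)
(* A process amounts to an occurrence structure in which every place has at most
   one producer and at most one consumer, and its linearizations are firing
   sequences of N.  Finite processes with a common linearization are swapping
   equivalent: exchanging places repairs the consumer assignment at the earliest
   event where the two differ.  Two concurrently enabled adjacent transitions
   share a process with their permutation, so permuting concurrent transitions
   does not change the swapping class either.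

   In a conflict-free structural conflict net distinct transitions enabled at a
   reachable marking have disjoint presets, so an enabled transition stays
   enabled, and commutes with what fires, until it fires itself.  In a maximal
   process Q it must eventually fire, as otherwise the tokens enabling it would
   remain unconsumed in Q.  Hence every firing sequence extends to a permutation
   of a linearization of a finite prefix of Q, so BD(Q) consists of all classes of
   finite processes, whatever Q is.  A maximal process exists by Zorn's lemma. *)
Require Import Defs.
From mathcomp Require Import all_boot all_order all_classical.
From mathcomp Require Import zify.
From Stdlib Require Import Relation_Operators Operators_Properties.

Set Implicit Arguments.
Unset Strict Implicit.
Unset Printing Implicit Defensive.

Local Open Scope classical_set_scope.


(** * Cardinalities of finite sets and multisets *)

Section FiniteCardinals.
Local Open Scope card_scope.
Variable T : Type.
Implicit Types (A B : set T) (n m : nat).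

Lemma card_seqP A n :
  A #= `I_n <-> exists l : seq {classic T}, [/\ uniq l, size l = n & A = [set` l]].
Proof.
split=> [An|[l [ul <- ->]]].
  have Af : finite_set A by apply/finite_setP; exists n.
  exists (finmap.enum_fset (fset_set (A : set {classic T}))); split.
    exact: finmap.fset_uniq.
    exact: (@card_fset_set {classic T} A n An).
  by rewrite (@fset_setK {classic T}).
elim: l ul => [|x l IH] /=; first by rewrite set_nil II0.
case/andP=> xl /IH {}IH; apply/eq_cardSP; exists x; first by rewrite /= mem_head.
rewrite (_ : _ `\ _ = [set` l]) //; apply/seteqP; split=> y /=.
  by rewrite inE => -[/orP[/eqP->|]].
by move=> yl; split; [rewrite inE yl orbT | move=> yx; rewrite -yx yl in xl].
Qed.

Lemma card_uniq_II A n m : A #= `I_n -> A #= `I_m -> n = m.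
Proof. by move=> An Am; apply/card_eq_II; rewrite -(card_eql An). Qed.

Lemma card_sub_II A B n : A `<=` B -> B #= `I_n ->
  exists2 m, m <= n & A #= `I_m.
Proof.
move=> AB Bn; have /finite_setP[m Am] : finite_set A.
  by apply: sub_finite_set AB _; apply/finite_setP; exists n.
exists m => //; rewrite -card_le_II -(card_le_eql Am) -(card_le_eqr Bn).
exact: subset_card_le.
Qed.

Lemma card_setU_II A B n m : A `&` B = set0 -> A #= `I_n -> B #= `I_m ->
  A `|` B #= `I_(n + m).
Proof.
move=> AB0 /card_seqP[k [uk <- Ak]] /card_seqP[l [ul <- Bl]].
apply/card_seqP; exists (k ++ l); split; last 2 first.
- exact: size_cat.
- by apply/seteqP; split=> x /=; rewrite mem_cat Ak Bl => /orP.
rewrite cat_uniq uk ul andbT /=; apply/hasPn => x xl; apply/negP => xk.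
have : (A `&` B) x by split; rewrite ?Ak ?Bl.
by rewrite AB0.
Qed.

Lemma card_setD_II A B n m : B `<=` A -> A #= `I_n -> B #= `I_m ->
  m <= n /\ A `\` B #= `I_(n - m).
Proof.
move=> BA An Bm.
have [k _ Dk] := card_sub_II (@subDsetl _ A B) An.
have : B `|` (A `\` B) #= `I_(m + k).
  by apply: card_setU_II Bm Dk; rewrite setDE setICA setICr setI0.
rewrite setDUK // => Amk; rewrite (card_uniq_II An Amk).
by rewrite leq_addr addKn.
Qed.

Lemma card_subset_II A n m : A #= `I_n -> m <= n ->
  exists2 B, B `<=` A & B #= `I_m.
Proof.
move=> /card_seqP[l [ul <- ->]] mn; exists [set` take m l] => [x /=|].
  exact: mem_take.
by apply/card_seqP; exists (take m l); rewrite take_uniq // size_takel.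
Qed.

Lemma card_sub_eq A B n : A `<=` B -> A #= `I_n -> B #= `I_n -> A = B.
Proof.
move=> AB An Bn; have [_] := card_setD_II AB Bn An.
rewrite subnn II0 card_eq0 => /eqP BA0; rewrite -(setDUK AB) BA0 setU0 //.
Qed.

Lemma card_gt0_II A n : A #= `I_n -> 0 < n <-> A !=set0.
Proof.
move=> An; split=> [|[x Ax]].
  case: n An => // n /eq_cardSP[x Ax _] _; by exists x.
case: n An => //; rewrite II0 card_eq0 => /eqP A0; by rewrite A0 in Ax.
Qed.

End FiniteCardinals.

Lemma card_image_II (T U : Type) (f : T -> U) (A : set T) n : injective f ->
  (f @` A #= `I_n)%card = (A #= `I_n)%card.
Proof.
move=> fI; apply: card_eql; apply: inj_card_eq => x y _ _; exact: fI.
Qed.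

(** Places will be matched by producer and label, and events by position: corresponding fibres are
    finite of equal size, so bijections chosen fibre by fibre glue together. *)
Lemma fiber_bijection (A B I : Type) (f : A -> I) (g : B -> I) :
  (forall i, exists n, (f @^-1` [set i] #= `I_n /\ g @^-1` [set i] #= `I_n)%card) ->
  exists2 h : A -> B, bijective h & forall a, g (h a) = f a.
Proof.
move=> fg.
have fib i : exists h : f @^-1` [set i] -> g @^-1` [set i], bijective h.
  have [n [fn gn]] := fg i; apply/card_bijP.
  exact: card_eq_trans fn (card_esym gn).
pose h i := projT1 (cid (fib i)); have hb i : bijective (h i) := projT2 (cid (fib i)).
have fa a : a \in f @^-1` [set f a] by rewrite inE.
have gb b : b \in g @^-1` [set g b] by rewrite inE.
pose k a := val (h (f a) (SigSub (fa a))).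
have gk a : g (k a) = f a by rewrite /k; case: (h _ _) => b /=; rewrite inE.
have kE i a (ai : a \in f @^-1` [set i]) : k a = val (h i (SigSub ai)).
  have e : f a = i by move/set_mem: (ai).
  subst i.
  by rewrite /k; congr (val (h _ _)); apply: val_inj.
exists k => //; rewrite -setTT_bijective; split=> // [a b _ _ kab|b _] /=.
  have fab : f a = f b by rewrite -!gk kab.
  have ba : b \in f @^-1` [set f a] by rewrite inE /= fab.
  move: kab; rewrite (kE _ _ (fa a)) (kE _ _ ba) => /val_inj/(bij_inj (hb _)).
  by move/(congr1 val).
have [h' _ hK] := hb (g b); case E: (h' (SigSub (gb b))) => [a ai].
exists a => //; rewrite (kE _ _ ai).
by have := hK (SigSub (gb b)); rewrite E => ->.
Qed.


Lemma has_card_mset_of (T : Type) (Y : set T) n :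
  has_card (mset_of Y) n <-> (Y #= `I_n)%card.
Proof.
have suppY : msupp (mset_of Y) = Y.
  apply/seteqP; split=> x; rewrite /msupp /mset_of /= lt0b; last by rewrite inE.
  exact: set_mem.
have cardY m : (Y #= `I_m)%card -> mcard (mset_of Y) = m.
  move=> /card_seqP[l [ul <- Yl]]; rewrite /mcard -(fsbig_widen [set` l]) //.
    rewrite -fsbig_seq // -sum1_size; apply: eq_big_seq => x xl.
    by rewrite /mset_of mem_set // Yl.
  by move=> x [_ xl] /=; rewrite /mset_of memNset // Yl.
split=> [[]|Yn]; last first.
  by split; [rewrite /mfinite suppY; apply/finite_setP; exists n | exact: cardY].
by rewrite /mfinite suppY => /finite_setP[m Ym] <-; rewrite (cardY m).
Qed.

Lemma mcap_mset_of (T U : Type) (f : T -> U) (Q : T -> Prop) s :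
  mcap (mset_of (f @^-1` [set s])) (fun x => `[<Q x>] : nat)
  = mset_of [set x | Q x /\ f x = s].
Proof.
apply/funext => x; rewrite /mcap /mset_of.
have -> : (x \in [set x | Q x /\ f x = s]) = (x \in f @^-1` [set s]) && `[<Q x>].
  apply/idP/andP => [/set_mem[Qx fx]|[/set_mem fx /asboolP Qx]].
    by split; [exact/mem_set | exact/asboolP].
  exact/mem_set.
by case: (x \in _); case: asbool.
Qed.

Lemma mset_of_asbool (T : Type) (Q : T -> Prop) :
  (fun x => `[<Q x>] : nat) = mset_of [set x | Q x].
Proof. by apply/funext => x; rewrite /mset_of; congr (nat_of_bool _); apply/asboolP/idP => [/mem_set|/set_mem]. Qed.

Lemma msupp_asbool (T : Type) (Q : T -> Prop) :
  msupp (fun x => `[<Q x>] : nat) = [set x | Q x].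
Proof.
apply/seteqP; split=> x /=; rewrite /msupp /= lt0b; first by move/asboolP.
by move=> Qx; apply/asboolP.
Qed.

Lemma finite_fibers (T U : Type) (f : T -> U) (Q : T -> Prop) (k : U -> nat) :
  finite_set (msupp k) ->
  (forall s, ([set x | Q x /\ f x = s] #= `I_(k s))%card) ->
  finite_set [set x | Q x].
Proof.
move=> kf Qk; apply: (@sub_finite_set _ _
    (\bigcup_(s in msupp k) [set x | Q x /\ f x = s])).
  by move=> x Qx; exists (f x) => //; apply/(card_gt0_II (Qk (f x))); exists x.
by apply: bigcup_finite => // s _; apply/finite_setP; exists (k s).
Qed.

Lemma set_Some (T : Type) (a : T) : [set e | Some a = Some e] = [set a].
Proof. by apply/seteqP; split=> e /= => [[]|] ->. Qed.

(** * Processes as occurrence structures *)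

Section OccurrenceStructures.
Variable N : net.

(* In a process the flow into a place and out of it amounts to two partial
   functions, its producer [org] and its consumer [con]. *)
Record ostruct := OStruct {
  pls : Type;
  evs : Type;
  org : pls -> option evs;
  con : pls -> option evs;
  plab : pls -> place N;
  elab : evs -> trans N }.

(** [good_rank] stands for both acyclicity and finiteness of pasts: the rank grows along causality,
    and every event has a finite preset. *)
Record good (O : ostruct) : Prop := Good {
  good_init : forall s,
    ([set p | @org O p = None /\ plab p = s] #= `I_(init s))%card;
  good_post : forall (e : evs O) s,
    ([set p | org p = Some e /\ plab p = s] #= `I_(flow_ts (elab e) s))%card;
  good_pre : forall (e : evs O) s,
    ([set p | con p = Some e /\ plab p = s] #= `I_(flow_st s (elab e)))%card;
  good_rank : exists r : evs O -> nat, forall p a b,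
    org p = Some a -> con p = Some b -> r a < r b }.

Definition preproc_of (O : ostruct) : preprocess N :=
  @PreProcess N
    (@PreNet (pls O) (evs O)
       (fun p e => `[<con p = Some e>]) (fun e p => `[<org p = Some e>])
       (fun p => `[<org p = None>]))
    (@plab O) (@elab O).

Section Good.
Variables (O : ostruct) (gO : good O).
Implicit Types (p : pls O) (e : evs O).

Lemma finite_pre e : finite_set [set p | con p = Some e].
Proof. by have [+ _ _] := netP (elab e); move/finite_fibers; apply; exact: good_pre. Qed.

Lemma finite_post e : finite_set [set p | org p = Some e].
Proof. by have [_ _ +] := netP (elab e); move/finite_fibers; apply; exact: good_post. Qed.

Lemma pre_nonempty e : exists p, con p = Some e.
Proof.
have [_ [s se] _] := netP (elab e).
by have [p []] := (card_gt0_II (good_pre gO e s)).1 se; exists p.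
Qed.

(** Doubling leaves room for the places: an event gets an odd number, a place the even number just
    above its producer, an initial place 0. *)
Lemma flow_plus_rank (r : evs O -> nat) :
  (forall p a b, org p = Some a -> con p = Some b -> r a < r b) ->
  let R (x : node (preproc_of O)) := match x with
    | inl p => if org p is Some a then (r a).*2.+2 else 0
    | inr e => (r e).*2.+1 end in
  forall x y, flow_plus x y -> R x < R y.
Proof.
move=> rP R x y; elim=> {x y} [[p|e] [q|f]|x y z _ xy _ yz] //=.
- rewrite lt0b => /asboolP pf; case pa : (org p) => [a|] //.
  by rewrite -doubleS ltnS leq_double; exact: rP pa pf.
- by rewrite lt0b => /asboolP ->.
- exact: ltn_trans xy yz.
Qed.

Lemma preproc_ofP : is_process (preproc_of O).
Proof.
have [r rP] := good_rank gO.
have optc (o : option (evs O)) : Defs.card_le (fun e => `[<o = Some e>] : nat) 1.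
  suff [n n1 [on oE]] : exists2 n, n <= 1 & has_card (mset_of [set e | o = Some e]) n.
    by rewrite mset_of_asbool; split; rewrite // oE.
  case: o => [a|]; [exists 1 | exists 0] => //; apply/has_card_mset_of.
    by rewrite set_Some card_set1.
  by rewrite II0 card_eq0; apply/eqP; rewrite -subset0.
split=> /=.
- move=> e; rewrite /pre_t /post_t /= !msupp_asbool.
  by split; [exact: finite_pre | exact: pre_nonempty | exact: finite_post].
- by move=> p; split; exact: optc.
- move=> p; rewrite /pre_s /= msupp_asbool.
  case: (org p) => [a|]; split=> /=.
  + move=> p0; have : [set e | Some a = Some e] a by []. by rewrite p0.
  + by rewrite asboolF.
  + by rewrite asboolT.
  + by case; rewrite -subset0 => ?.
- by move=> x /(flow_plus_rank rP); rewrite ltnn.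
- move=> u; have [n] := ubnP (r u); elim: n u => // n IH u run.
  apply: (@sub_finite_set _ _ (\bigcup_(p in [set p | con p = Some u])
     \bigcup_(a in [set a | org p = Some a])
        (a |` [set t | @flow_plus (preproc_of O) (inr t) (inr a)]))).
    move=> t /= /clos_trans_tn1_iff tu; inversion tu as [x tx|x z xz tx].
      by [].
    case: x xz tx => // p; rewrite /= lt0b => /asboolP pu tp.
    exists p => //; inversion tp as [x' tx'|y' z' yz' ty'].
      by move: tx'; rewrite /= lt0b => /asboolP tp'; exists t => //; left.
    case: y' yz' ty' => //= a; rewrite lt0b => /asboolP pa ta.
    by exists a => //; right; apply/clos_trans_tn1_iff.
  apply: bigcup_finite => [|p /= pu]; first exact: finite_pre.
  case pa : (org p) => [a|]; last first.
    by rewrite (_ : bigcup _ _ = set0) // -subset0 => ? [].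
  apply: bigcup_finite => [|b /= [<-]].
    by rewrite set_Some.
  rewrite finite_setU; split=> //; apply: IH.
  exact: leq_trans (rP _ _ _ pa pu) run.
- by move=> s; rewrite mcap_mset_of; apply/has_card_mset_of; exact: good_init.
- by move=> e s; rewrite mcap_mset_of; apply/has_card_mset_of; exact: good_pre.
- by move=> e s; rewrite mcap_mset_of; apply/has_card_mset_of; exact: good_post.
Qed.

Definition proc_of : process N := Process preproc_ofP.

End Good.
End OccurrenceStructures.


(** Two distinct elements of positive multiplicity would already give a sum of at least 2. This
    turns the branching condition on places into partial producer and consumer functions. *)
Lemma card_le1_option (T : Type) (m : mset T) : Defs.card_le m 1 ->
  exists o : option T, m = fun t => `[<o = Some t>] : nat.
Proof.
move=> [/finite_setP[n /card_seqP[l [ul _ ml]]]].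
have suppl x : 0 < m x -> x \in l by move=> mx; have : msupp m x by []; rewrite ml.
rewrite /mcard -(fsbig_widen [set` l]) //; last first.
  by move=> x [_ xl] /=; apply/eqP; rewrite -leqn0 leqNgt; apply/negP => /suppl.
rewrite -fsbig_seq // => le1.
have [[t mt]|no] := pselect (exists t, 0 < m t); last first.
  exists None; apply/funext => t; rewrite asboolF //=; apply/eqP.
  by rewrite -leqn0 leqNgt; apply/negP => mt; apply: no; exists t.
exists (Some t); apply/funext => u.
move: le1; rewrite (big_rem (t : {classic T})) ?suppl //=.
have [<-|tu] := pselect (t = u).
  by rewrite asboolT //=; case: (m t) mt => [|[|k]].
rewrite asboolF /=; last by case.
have [->//|mu] := posnP (m u); case: (m t) mt => // k _.
rewrite (big_rem (u : {classic T})) ?mem_rem_uniq ?inE ?suppl ?andbT //=.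
  case: (m u) mu => // j _ /=.
  by move/(leq_trans (leq_add (ltn0Sn k) (leq_trans (ltn0Sn j) (leq_addr _ _)))).
by apply/eqP => ut; apply: tu.
Qed.

(** * Every process as an occurrence structure *)

Section FromProcess.
Variable N : net.

(** The rank is the size of the past. If [a] precedes [b], the past of [b] contains that of [a] and
    [a] itself, which acyclicity keeps out of its own past. *)
Lemma past_rank (P : process N) : exists r : trans P -> nat,
  forall s a b, 0 < flow_ts a s -> 0 < flow_st s b -> r a < r b.
Proof.
case: P => P H /=; pose past (u : trans P) := [set t | @flow_plus P (inr t) (inr u)].
have /choice[r rP] u : exists n, (past u #= `I_n)%card.
  exact/finite_setP/(proc_past_finite H).
exists r => s a b sa sb.
have ab : @flow_plus P (inr a) (inr b).
  by apply: (@t_trans _ _ _ (inl s)); apply: t_step.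
have aU : (a |` past a #= `I_(1 + r a))%card.
  apply: card_setU_II (card_set1) (rP a); rewrite -subset0 => x [] /= ->.
  exact: (proc_acyclic H).
have [|m + aU'] := card_sub_II _ (rP b) (A := a |` past a).
  by move=> x [->|xa]; [exact: ab | exact: t_trans xa ab].
by rewrite (card_uniq_II aU' aU).
Qed.

(** An equality and not only an isomorphism, so later arguments may replace any process by an
    occurrence structure; validity proofs are identified by proof irrelevance. *)
Lemma processE (P : process N) : exists O (gO : @good N O), P = proc_of gO.
Proof.
have [r] := past_rank P.
case: P r => -[[S T st ts ini] ls lt] H /= r rP.
have [co stE] : exists co : S -> option T, st = fun p e => `[<co p = Some e>] : nat.
  have /choice[co coP] p := card_le1_option (proj2 (proc_branching H p)).
  by exists co; apply/funext => p; exact: coP.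
have [og tsE] : exists og : S -> option T, ts = fun e p => `[<og p = Some e>] : nat.
  have /choice[og ogP] p := card_le1_option (proj1 (proc_branching H p)).
  exists og; apply/funext => e; apply/funext => p.
  exact: (congr1 (fun f => f e) (ogP p)).
have iniE : ini = fun p => `[<og p = None>] : nat.
  apply/funext => p; have [] := proc_init H p; rewrite /pre_s /=.
  rewrite tsE msupp_asbool; case: (og p) => [a|]; last first.
    by move=> + _; rewrite asboolT // => ->//; rewrite -subset0 => ?.
  move=> _; rewrite asboolF // => -> // p0.
  by have : [set e | Some a = Some e] a by []; rewrite p0.
subst st ts ini.
have gO : good (@OStruct N S T og co ls lt).
  split=> /=.
  - by move=> s; have := proc_pi_init H s; rewrite /= mcap_mset_of => /has_card_mset_of.
  - by move=> e s; have := proc_pi_post H e s; rewrite /= mcap_mset_of => /has_card_mset_of.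
  - by move=> e s; have := proc_pi_pre H e s; rewrite /= mcap_mset_of => /has_card_mset_of.
  - by exists r => p a b pa pb; apply: (rP p); rewrite lt0b; apply/asboolP.
exists _, gO; rewrite /proc_of; congr Process; exact: Prop_irrelevance.
Qed.

End FromProcess.


(** * Permutation of firing sequences *)

Section FiringSequences.
Variable N : net.
Implicit Types (M : mset (place N)) (t u : {classic trans N})
  (l k : seq {classic trans N}).

Definition en M t := msubset (pre_t t) M.

Definition step M t : mset (place N) := fun s => M s - pre_t t s + post_t t s.

Fixpoint firable M l : Prop :=
  if l is t :: l' then en M t /\ firable (step M t) l' else True.

Definition run M l := foldl step M l.

Lemma firable_cat M l k : firable M (l ++ k) <-> firable M l /\ firable (run M l) k.
Proof.
elim: l M => [|t l IH] M /=; first by split=> [|[]].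
by split=> [[? /IH[]]|[[? ?] ?]]; last by split=> //; apply/IH.
Qed.

Lemma run_cat M l k : run M (l ++ k) = run (run M l) k.
Proof. exact: foldl_cat. Qed.

Lemma msum_single (f : trans N -> nat) t :
  \big[addn/0]_(u \in [set: {classic trans N}]) (mset_of [set t] u * f u) = f t.
Proof.
rewrite -(fsbig_widen [set t : {classic trans N}]) //.
  by rewrite fsbig_set1 /mset_of mem_set // mul1n.
by move=> u [_ ut] /=; rewrite /mset_of memNset // mul0n.
Qed.

Lemma msupp_single t : msupp (mset_of [set t]) = [set t].
Proof.
apply/seteqP; split=> u; rewrite /msupp /mset_of /= lt0b; first exact: set_mem.
by move=> ->; rewrite mem_set.
Qed.

Lemma fires_single M t M' :
  fires M (mset_of [set t]) M' <-> en M t /\ M' = step M t.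
Proof.
have pE : pre_m (mset_of [set t]) = pre_t t by apply/funext => s; exact: msum_single.
have qE : post_m (mset_of [set t]) = post_t t by apply/funext => s; exact: msum_single.
rewrite /fires pE qE; split=> [[_ ? ?]|[? ->]]; split=> //.
split; rewrite /mfinite msupp_single; first exact: finite_set1.
by exists t.
Qed.

Lemma firable_fires_seq M l : firable M l -> fires_seq M l (run M l).
Proof.
elim: l M => //= t l IH M [Mt /IH]; exists (step M t) => //.
exact/fires_single.
Qed.

(** Permutations of concurrent neighbours: [sim_swap] asks that the marking cover both presets
    together. *)
Inductive sim : mset (place N) -> seq {classic trans N} -> seq {classic trans N} -> Prop :=
| sim_refl M l : sim M l l
| sim_trans M l k m : sim M l k -> sim M k m -> sim M l m
| sim_cons M t l k : sim (step M t) l k -> sim M (t :: l) (t :: k)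
| sim_swap M t u l : (forall s, pre_t t s + pre_t u s <= M s) ->
    sim M (t :: u :: l) (u :: t :: l).

Lemma sim_cat M m l k : sim (run M m) l k -> sim M (m ++ l) (m ++ k).
Proof. by elim: m M => //= t m IH M /IH; exact: sim_cons. Qed.

Lemma sim_catr M l k m : sim M l k -> sim M (l ++ m) (k ++ m).
Proof.
elim=> {M l k} [M l|M l k n _ IH1 _ IH2|M t l k _ IH|M t u l tu] /=.
- exact: sim_refl.
- exact: sim_trans IH1 IH2.
- exact: sim_cons.
- exact: sim_swap.
Qed.

Lemma stepC M t u : (forall s, pre_t t s + pre_t u s <= M s) ->
  step (step M t) u = step (step M u) t.
Proof. by move=> tu; apply/funext => s; rewrite /step; have := tu s; lia. Qed.

Lemma sim_run M l k : sim M l k -> firable M l -> firable M k /\ run M l = run M k.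
Proof.
elim=> {M l k} [M l|M l k n _ IH1 _ IH2|M t l k _ IH|M t u l tu] //=.
- by move=> /IH1[/IH2[? <-] ->].
- by move=> [? /IH[? ?]].
rewrite (stepC tu) => -[tM [uM ml]]; split=> //; split.
  by move=> s; have := tu s; lia.
by split=> // s; rewrite /step; have := tu s; lia.
Qed.

(** The only form in which the two hypotheses on the net enter the later arguments. *)
Definition persistent := forall m t u, firable (@init N) m ->
  en (run (@init N) m) t -> en (run (@init N) m) u -> t <> u ->
  forall s, pre_t t s = 0 \/ pre_t u s = 0.

(** As [t] and [u] differ, [G] restricts to single enabled transitions, so conflict-freeness enables
    [G] itself, and the structural condition then separates the presets. *)
Lemma persistent_cf_scn : conflict_free N -> structural_conflict_net N -> persistent.
Proof.
move=> hcf hsc m t u fm; set M := run _ m => Mt Mu tu.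
have rM : reachable M by exists m; exact: firable_fires_seq.
pose G : mset (trans N) := madd (mset_of [set t]) (mset_of [set u]).
have sG : msupp G = [set t; u].
  apply/seteqP; split=> v; rewrite /msupp /G /madd /mset_of /= addn_gt0 !lt0b.
    by case/orP=> /set_mem ->; [left|right].
  by case=> ->; [rewrite mem_set | rewrite orbC mem_set].
have en1 v : en M v -> mrestrict G [set v] = mset_of [set v] ->
    enabled M (mrestrict G [set v]).
  by move=> Mv ->; exists (step M v); apply/fires_single.
have EG : enabled M G.
  apply: contrapT => nG; apply: (hcf G M) => //.
    by split; rewrite /mfinite sG; [exact: finite_set2 | exists t; left].
  split=> // v; rewrite sG => -[] ->; apply: en1 => //.
    apply/funext => w; rewrite /mrestrict /G /madd /mset_of.
    have [/set_mem ->|//] := boolP (w \in [set t]).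
    by rewrite memNset.
  apply/funext => w; rewrite /mrestrict /G /madd /mset_of.
  have [/set_mem ->|//] := boolP (w \in [set u]).
  by rewrite memNset // => /esym.
have /seteqP[+ _] := hsc t u (ex_intro2 _ _ M rM EG).
move=> H s; have := H s; rewrite /msupp /mcap /= leq_min.
by case: (pre_t t s) => [|a]; case: (pre_t u s) => [|b] ab; [left|left|right|case: ab].
Qed.

Hypothesis pers : persistent.

(** The first transition of [l] differs from [t], hence has a disjoint preset: it leaves [t] enabled
    and commutes with it. Induct along [l]. *)
Lemma delay m l t : firable (@init N) (m ++ l) -> en (run (@init N) m) t ->
  t \notin l ->
  en (run (@init N) (m ++ l)) t /\ sim (run (@init N) m) (rcons l t) (t :: l).
Proof.
elim: l m => [|u l IH] m.
  by rewrite cats0 => _ mt _; split=> //; exact: sim_refl.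
rewrite -cat_rcons inE negb_or => fml mt /andP[/eqP tu tl].
have fm : firable (@init N) m.
  by move: fml; rewrite cat_rcons => /firable_cat[].
have mu : en (run (@init N) m) u.
  by move: fml; rewrite cat_rcons => /firable_cat[_ []].
have dis s : pre_t t s = 0 \/ pre_t u s = 0 by apply: pers fm _ _ _ s.
have runE : run (@init N) (rcons m u) = step (run (@init N) m) u.
  by rewrite -cats1 run_cat.
have [|Mt lt] := IH (rcons m u) fml _ tl.
  by rewrite runE => s; have := mt s; have := dis s; rewrite /step; lia.
split=> //; apply: sim_trans (sim_swap _ _).
  by rewrite rcons_cons; apply: sim_cons; rewrite -runE.
by move=> s; have := mt s; have := mu s; case: (dis s) => ->; rewrite ?addn0.
Qed.
End FiringSequences.


(** * Linearizations *)

Section Schedules.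
Variables (N : net) (O : ostruct N).
Implicit Types (p : pls O) (e a : {classic evs O}) (es fs : seq {classic evs O}).

(** An event is appended once the producers of all its preplaces have occurred, so a schedule lists
    a finite causally closed set of events in a causal order. *)
Inductive schedule : seq {classic evs O} -> Prop :=
| schedule_nil : schedule [::]
| schedule_snoc es e : schedule es -> e \notin es ->
    (forall p a, org p = Some a -> con p = Some e -> a \in es) ->
    schedule (rcons es e).

Lemma schedule_rcons es e : schedule (rcons es e) <->
  [/\ schedule es, e \notin es
    & forall p a, org p = Some a -> con p = Some e -> a \in es].
Proof.
split=> [H|[? ? ?]]; last exact: schedule_snoc.
inversion H as [E|es' e' ? ? ? E]; first by case: es E {H}.
by have [<- <-] := rcons_inj E.
Qed.

Lemma schedule_cat es fs : schedule (es ++ fs) -> schedule es.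
Proof.
elim/last_ind: fs => [|fs e IH]; first by rewrite cats0.
by rewrite -rcons_cat => /schedule_rcons[/IH].
Qed.

Lemma schedule_closed es : schedule es -> forall p a e,
  org p = Some a -> con p = Some e -> e \in es -> a \in es.
Proof.
elim=> // {}es f _ IH fes fP p a e pa pe; rewrite !mem_rcons !inE.
case/orP=> [/eqP ef|/(IH _ _ _ pa pe) ->]; last exact: orbT.
by rewrite (fP _ _ pa) ?orbT // -ef.
Qed.

Lemma schedule_uniq es : schedule es -> uniq es.
Proof. by elim=> // {}es e _ ues ees _; rewrite rcons_uniq ees. Qed.

(** The cut reached by a schedule [es]: the places holding a token once exactly these events have
    occurred. *)
Definition free es : set (pls O) := [set p |
  (forall a, org p = Some a -> a \in es) /\ (forall e, con p = Some e -> e \notin es)].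

Definition trace es : seq {classic trans N} := map (@elab N O) es.

Hypothesis gO : good O.

(** Appending [e] takes its preplaces out of the cut and adds its postplaces, and labels count both
    by the arc weights of [elab e]; so the cut keeps representing the marking. *)
Lemma schedule_trace es : schedule es -> firable (@init N) (trace es) /\
  forall s, (free es `&` [set p | plab p = s] #= `I_(run (@init N) (trace es) s))%card.
Proof.
elim=> [|{}es e ses [IHf IHr] ees eP].
  split=> // s; rewrite (_ : _ `&` _ = [set p | org p = None /\ plab p = s]).
    exact: good_init.
  apply/seteqP; split=> p /= [h <-]; split=> //; last by split=> [a|//]; rewrite h.
  by case: h; case: (org p) => // a /(_ a erefl).
pose Pre s := [set p | con p = Some e /\ plab p = s].
pose Post s := [set p | org p = Some e /\ plab p = s].
have PreF s : Pre s `<=` free es `&` [set p | plab p = s].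
  move=> p [pe ps]; split=> //; split=> [a pa|f]; first exact: eP pa pe.
  by rewrite pe => -[<-].
have PrePost s : (free es `&` [set p | plab p = s]) `\` Pre s `|` Post s
    = free (rcons es e) `&` [set p | plab p = s].
  apply/seteqP; split=> p /=.
    case=> [[[[pa pf] ps] npe]|[pe ps]]; split=> //; split=> [a|f].
    - by move=> /pa; rewrite mem_rcons inE orbC => ->.
    - move=> pf'; rewrite mem_rcons inE negb_or pf // andbT.
      by apply/eqP => fe; apply: npe; split=> //; rewrite pf' fe.
    - by rewrite pe => -[<-]; rewrite mem_rcons mem_head.
    (* A postplace of [e] is still unconsumed: if [e] or an event of [es] consumed it, [e] would
       have to lie in [es] already. *)
    - move=> pf; rewrite mem_rcons inE negb_or; apply/andP; split; apply/negP.
        by move=> /eqP fe; move: (eP p e pe); rewrite pf fe => /(_ erefl); apply/negP.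
      by move=> fes; move/negP: ees; apply; exact: schedule_closed pe pf fes.
  case=> -[pa pf] ps; have [pe|npe] := pselect (org p = Some e); [by right | left].
  split; last first.
    by case=> pe _; have := pf e pe; rewrite mem_rcons mem_head.
  split=> //; split=> [a pa'|f /pf].
    have := pa a pa'; rewrite mem_rcons inE => /orP[/eqP ae|//].
    by case: npe; rewrite pa' ae.
  by rewrite mem_rcons inE negb_or => /andP[].
have D s := card_setD_II (PreF s) (IHr s) (good_pre gO e s).
rewrite /trace map_rcons -cats1; split.
  by apply/firable_cat; split=> //; split=> // s; have [] := D s.
move=> s; rewrite run_cat -PrePost; apply: card_setU_II (good_post gO e s).
  rewrite -subset0 => p [[[[pa _] _] _] [pe _]].
  by move/negP: ees; apply; exact: pa.
by have [_] := D s.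
Qed.

End Schedules.

Arguments trace {N O}.

(** * Embeddings between occurrence structures *)

Section Embeddings.
Variable N : net.

(** [emb_con] is weaker than an equation like [emb_org]: a place without consumer in [O'] may be
    consumed in [O] by an event outside the range of [g]. *)
Record embedding (O' O : ostruct N) (f : pls O' -> pls O) (g : evs O' -> evs O) :
    Prop := Embedding {
  emb_inj_s : injective f;
  emb_inj_t : injective g;
  emb_init : forall p, org p = None -> exists q, f q = p;
  emb_org : forall p, org (f p) = omap g (org p);
  emb_con : forall p e, con (f p) = Some (g e) <-> con p = Some e;
  emb_plab : forall p, plab (f p) = plab p;
  emb_elab : forall e, elab (g e) = elab e }.

Lemma embedding_inclusion (O' O : ostruct N) (gO' : good O') (gO : good O) f g :
  embedding f g -> @inclusion N (proc_of gO') (proc_of gO) f g.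
Proof.
case=> fI gI fi og cn lf lg; split=> //= [p|p np|p e|e p].
- by rewrite og; case: (org p) => [a|] /=; [rewrite !asboolF | rewrite !asboolT].
- by rewrite asboolF // => /fi[q qp]; apply: np; exists q.
- by congr nat_of_bool; apply: asbool_equiv_eq; exact: cn.
- congr nat_of_bool; apply: asbool_equiv_eq; rewrite og.
  by split=> [|->//]; case: (org p) => //= a [/gI ->].
Qed.

Lemma embedding_id (O : ostruct N) : embedding (@id (pls O)) (@id (evs O)).
Proof.
by split=> // p; [exists p | case: (org p)].
Qed.

Lemma embedding_comp (O1 O2 O3 : ostruct N) f1 g1 f2 g2 :
  @embedding O2 O3 f2 g2 -> @embedding O1 O2 f1 g1 ->
  embedding (f2 \o f1) (g2 \o g1).
Proof.
case=> fI2 gI2 fi2 og2 cn2 lf2 lg2 [fI1 gI1 fi1 og1 cn1 lf1 lg1]; split=> /=.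
- exact: inj_comp.
- exact: inj_comp.
- move=> p p0; have [q qp] := fi2 p p0.
  have [|r rq] := fi1 q; last by exists r; rewrite rq.
  by move: p0; rewrite -qp og2; case: (org q).
- by move=> p; rewrite og2 og1; case: (org p).
- by move=> p e; rewrite cn2 cn1.
- by move=> p; rewrite lf2.
- by move=> p; rewrite lg2.
Qed.

End Embeddings.


(** * Adding an event *)

Section Extension.
Variables (N : net) (O : ostruct N) (t : trans N) (A : set (pls O)).

Definition new_pls : Type := {x : place N * nat | x.2 < flow_ts t x.1}.

(** [None] is the added event: its preset is [A], and it produces [new_pls], one place per unit of
    weight on the arcs leaving [t]. *)
Definition ext : ostruct N := @OStruct N (pls O + new_pls) (option (evs O))
  (fun x => if x is inl p then omap Some (org p) else Some None)
  (fun x => if x is inl p then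
              if p \in A then Some None else omap Some (con p)
            else None)
  (fun x => match x with inl p => plab p | inr q => (val q).1 end)
  (fun e => if e is Some e then elab e else t).

Hypothesis gO : good O.
Hypothesis Afree : forall p, A p -> con p = None.
Hypothesis Acard : forall s, (A `&` [set p | plab p = s] #= `I_(flow_st s t))%card.

Lemma card_new_pls s : ([set q : new_pls | (val q).1 = s] #= `I_(flow_ts t s))%card.
Proof.
rewrite (_ : `I_ _ = (fun q : new_pls => (val q).2) @` [set q | (val q).1 = s]).
  apply: card_esym; apply: inj_card_eq => -[[s1 i1] h1] [[s2 i2] h2].
  rewrite !inE /= => e1 e2 i12; apply: val_inj => /=; congruence.
apply/seteqP; split=> [i /= it|_ [[[s' i'] it] /= <- <-]] //.
by exists (exist _ (s, i) it : new_pls).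
Qed.

Lemma finite_choice : exists l : seq {classic pls O}, A = [set` l].
Proof.
have [tf _ _] := netP t.
exact/(@finite_seqP {classic pls O})/(finite_fibers tf Acard).
Qed.

Lemma good_ext : good ext.
Proof.
have inlE (Q : pls O -> Prop) (Q' : pls ext -> Prop) n :
    (forall p, Q p <-> Q' (inl p)) -> (forall q, ~ Q' (inr q)) ->
    ([set p | Q p] #= `I_n)%card -> ([set x | Q' x] #= `I_n)%card.
  move=> QQ' nQ'; rewrite -(card_image_II (f := @inl _ new_pls)); last by move=> ? ? [].
  rewrite (_ : _ @` _ = [set x | Q' x]) //; apply/seteqP.
  by split=> [_ [p /= /QQ' ? <-]|[p /= /QQ' ?|q /nQ' []]] //; exists p.
split=> /=.
- move=> s; apply: inlE (good_init gO s) => [p|q [] //].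
  by case: (org p) => [a|]; split=> -[].
- move=> [e|] s.
    apply: inlE (good_post gO e s) => [p|q [] //].
    by case: (org p) => [a|]; split=> -[] // [->].
  move: (card_new_pls s); rewrite -(card_image_II (f := @inr (pls O) _)); last by move=> ? ? [].
  rewrite (_ : _ @` _ = [set x | @org N ext x = Some None /\ plab x = s]) //; apply/seteqP.
  split=> [_ [q /= qs <-]|[p|q] /= []] //; first by case: (org p).
  by move=> _ qs; exists q.
- move=> [e|] s.
    apply: inlE (good_pre gO e s) => [p|q [] //].
    have [/set_mem/Afree ->|_] := boolP (p \in A); first by split=> -[].
    by case: (con p) => [a|]; split=> -[] // [->].
  apply: inlE (Acard s) => [p|q [] //].
  have [/set_mem|/negP pA] := boolP (p \in A); first by split=> -[].
  by split=> [[/mem_set] //|[]]; case: (con p).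
- have [r rP] := good_rank gO; have [l lA] := finite_choice.
  (* The added event gets the maximum of [rk] over its finite preset [A], hence exceeds all
     producers there; its own postplaces are unconsumed and impose nothing. *)
  pose rk p := if org p is Some a then (r a).+1 else 0.
  exists (fun e => if e is Some e then r e else \max_(p <- l) rk p).
  move=> [p|q] a b //=; case pa : (org p) => [a'|] //= [<-].
  case: ifPn => [/set_mem Ap [<-]|_].
    have pl : (p : {classic pls O}) \in l by move: Ap; rewrite lA.
    by have := @leq_bigmax_seq _ l xpredT rk p pl isT; rewrite {1}/rk pa.
  by case pb : (con p) => [b'|] //= [<-]; exact: rP pa pb.
Qed.

Lemma embedding_ext : @embedding N O ext inl Some.
Proof.
split=> //=; try by move=> a b [].
  by move=> [p|q] // _; exists p.
move=> p e.
have [/set_mem/Afree ->|_] := boolP (p \in A); first by split.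
by case: (con p) => [a|] //=; split=> [[->]|[->]].
Qed.

Lemma schedule_ext_old es : schedule es -> @schedule N ext (map Some es).
Proof.
elim=> {es} [|es e _ IH ees eP]; first exact: schedule_nil.
rewrite map_rcons; apply: schedule_snoc => //.
  by rewrite (mem_map (T1 := {classic evs O}) (T2 := {classic option (evs O)})) // => ? ? [].
move=> [p|q] [a|] //=; case pa : (org p) => [a'|] //= [<-].
case: ifP => // _; case pe : (con p) => [e'|] //= [ee].
apply: (map_f (T1 := {classic evs O}) (T2 := {classic option (evs O)})).
by apply: eP pa _; rewrite -ee.
Qed.

Lemma schedule_ext es : schedule es -> A `<=` free es ->
  @schedule N ext (rcons (map Some es) None).
Proof.
move=> ses Aes; apply: schedule_snoc; first exact: schedule_ext_old.
  by apply/negP => /(mapP (T1 := {classic evs O}) (T2 := {classic option (evs O)}))[].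
move=> [p|q] [a|] //=; case pa : (org p) => [a'|] //= [<-].
case: ifPn => [/set_mem Ap _|_]; last by case: (con p).
apply: (map_f (T1 := {classic evs O}) (T2 := {classic option (evs O)})).
by have [+ _] := Aes p Ap; apply.
Qed.

End Extension.

(** * The prefix given by a schedule *)

Section Restriction.
Variables (N : net) (O : ostruct N) (es : seq {classic evs O}).

(** All initial places stay, as do the places produced by [es]; consumers outside [es] are
    forgotten, [insub] being [None] there. *)
Definition restr : ostruct N := @OStruct N
  {p : pls O | `[< forall a, org p = Some a -> (a : {classic evs O}) \in es >]}
  {e : evs O | (e : {classic evs O}) \in es}
  (fun p => obind insub (org (val p))) (fun p => obind insub (con (val p)))
  (fun p => plab (val p)) (fun e => elab (val e)).

Hypothesis gO : good O.
Hypothesis ses : schedule es.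

Lemma restr_con (p : pls restr) e : con p = Some e <-> con (val p) = Some (val e).
Proof.
rewrite /=; case: (con (val p)) => [a|] //=; case: insubP => [u _ <-|aes].
  by split=> [[->]|[/val_inj ->]].
by split=> // -[E]; rewrite E (valP e) in aes.
Qed.

Lemma restr_org (p : pls restr) : org (val p) = omap val (org p).
Proof.
case: p => p pP /=; case pa : (org p) => [a|] //=.
by rewrite insubT //; move/asboolP: pP => /(_ a pa).
Qed.

Lemma embedding_restr : @embedding N restr O val val.
Proof.
split=> //; try exact: val_inj; last 2 first.
- exact: restr_org.
- by move=> p e; rewrite restr_con.
move=> p p0.
have pP : `[< forall a, org p = Some a -> (a : {classic evs O}) \in es >].
  by apply/asboolP => a; rewrite p0.
by exists (exist _ p pP : pls restr).
Qed.

Lemma good_restr : good restr.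
Proof.
have valE (Q : pls O -> Prop) (Q' : pls restr -> Prop) n :
    (forall p, Q (val p) <-> Q' p) ->
    (forall p, Q p -> forall a, org p = Some a -> (a : {classic evs O}) \in es) ->
    ([set p | Q p] #= `I_n)%card -> ([set x | Q' x] #= `I_n)%card.
  move=> QQ' QP; rewrite -[in X in _ -> X](card_image_II (f := val)); last exact: val_inj.
  rewrite (_ : _ @` _ = [set p | Q p]) //; apply/seteqP.
  split=> [_ [p /= /QQ' ? <-] //|p /= Qp].
  exists (exist _ p (asboolT (QP p Qp)) : pls restr) => //; exact/QQ'.
split.
- move=> s; apply: valE (good_init gO s) => [p|p [-> _] //].
  by rewrite restr_org; case: (@org N restr p) => [a|]; split=> -[].
- move=> e s; apply: valE (good_post gO (val e) s) => [p|p [-> _] a [<-]].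
    rewrite restr_org; case: (@org N restr p) => [a|]; split=> -[] //.
      by move=> [/val_inj ->].
    by move=> [->].
  exact: valP e.
- move=> e s; apply: valE (good_pre gO (val e) s) => [p|p [pe _] a pa].
    by rewrite restr_con.
  exact: schedule_closed ses _ _ _ pa pe (valP e).
- have [r rP] := good_rank gO; exists (r \o val) => p a b pa /restr_con pb /=.
  by apply: rP pb; rewrite restr_org pa.
Qed.

Lemma schedule_restr : exists rs : seq {classic evs restr},
  [/\ schedule rs, map val rs = es & forall e, e \in rs].
Proof.
pose rval (e : {classic evs restr}) : {classic evs O} := val e.
have lift (l : seq {classic evs O}) : {subset l <= es} -> exists rs : seq {classic evs restr}, map rval rs = l.
  elim: l => [|e l IH] sub; first by exists [::].
  have [|rs rsl] := IH; first by move=> x xl; apply: sub; rewrite inE xl orbT.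
  exists ((exist _ e (sub e (mem_head _ _)) : evs restr) :: rs) => /=.
  by rewrite rsl.
have [rs rsE] := lift es (fun _ => id).
have memE e (l : seq {classic evs restr}) : (e \in l) = (rval e \in map rval l).
  by rewrite mem_map //; exact: val_inj.
exists rs; split=> // [|e]; last by rewrite memE rsE; exact: valP e.
move: ses; rewrite -{1}rsE; elim/last_ind: (rs) => [|l e IH].
  by move=> _; exact: schedule_nil.
rewrite map_rcons => /schedule_rcons[/IH sl el eP]; apply: schedule_snoc => //.
  by rewrite memE.
by move=> p a pa /restr_con pe; rewrite memE; apply: eP pe; rewrite restr_org pa.
Qed.

Lemma finite_restr : finite_set [set: evs restr].
Proof.
have [rs [_ _ rsP]] := schedule_restr.
by apply/(@finite_seqP {classic evs restr}); exists rs; apply/seteqP; split=> e //= _; exact: rsP.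
Qed.

End Restriction.


(** * Extending and reordering linearizations *)

Section Linearizations.
Variable N : net.
Implicit Types O : ostruct N.

Definition linearization O (es : seq {classic evs O}) :=
  schedule es /\ forall e, e \in es.

Lemma trace_map O' O (f : pls O' -> pls O) (g : evs O' -> evs O)
    (es : seq {classic evs O'}) :
  embedding f g -> trace (map g es : seq {classic evs O}) = trace es.
Proof. by move=> fg; rewrite /trace -map_comp; apply: eq_map => e; exact: emb_elab fg e. Qed.

Lemma trace_cat O (es fs : seq {classic evs O}) : trace (es ++ fs) = trace es ++ trace fs.
Proof. exact: map_cat. Qed.

(** Tokens are picked for each label separately; the choices cannot interfere because each place has
    a single label. *)
Lemma choose_tokens O (C : set (pls O)) (k m : place N -> nat) :
  (forall s, (C `&` [set p | plab p = s] #= `I_(m s))%card) -> (forall s, k s <= m s) ->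
  exists2 A, A `<=` C & forall s, (A `&` [set p | plab p = s] #= `I_(k s))%card.
Proof.
move=> Cm km.
have /choice[B BP] s : exists B, B `<=` C `&` [set p | plab p = s] /\ (B #= `I_(k s))%card.
  by have [B BC Bk] := card_subset_II (Cm s) (km s); exists B.
exists [set p | B (plab p) p] => [p /= /((BP _).1)[]//|s].
rewrite (_ : _ `&` _ = B s); first by have [] := BP s.
by apply/seteqP; split=> p /= => [[Bp <-] //|Bp]; have [_ /= ps] := (BP s).1 p Bp; rewrite ps.
Qed.

Lemma free_linearization O (es : seq {classic evs O}) : linearization es ->
  free es = [set p | con p = None].
Proof.
move=> [_ esP]; apply/seteqP; split=> p /=.
  by case=> _; case: (con p) => // e /(_ e erefl); rewrite esP.
by move=> pn; split=> [a _|e]; [exact: esP | rewrite pn].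
Qed.

Lemma linearization_ext O t (A : set (pls O)) (es : seq {classic evs O}) :
  (forall p, A p -> con p = None) -> linearization es ->
  @linearization (ext t A) (rcons (map Some es) None).
Proof.
move=> AN les; split; last first.
  move=> [e|]; rewrite mem_rcons inE; last by rewrite eqxx.
  apply/orP; right.
  by rewrite (map_f (T1 := {classic evs O}) (T2 := {classic option (evs O)})) // les.2.
by apply: (@schedule_ext N O t A es les.1); rewrite free_linearization.
Qed.

Lemma trace_ext O t (A : set (pls O)) (es : seq {classic evs O}) :
  @trace _ (ext t A) (rcons (map Some es) None) = rcons (trace es) t.
Proof. by rewrite /trace map_rcons -map_comp. Qed.

(** Each transition of [l] finds its tokens in the final cut and is added as a new event. The suffix
    [ns] serves all linearizations of [O] at once, so two orders of [O] extend in one and the same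
    structure. *)
Lemma linearization_extend O (gO : good O) (es : seq {classic evs O}) l :
  linearization es -> firable (run (@init N) (trace es)) l ->
  exists O' (gO' : good O') (f : pls O -> pls O') (g : evs O -> evs O')
    (ns : seq {classic evs O'}),
  [/\ embedding f g, trace ns = l
    & forall fs : seq {classic evs O}, linearization fs ->
        linearization ((map g fs : seq {classic evs O'}) ++ ns)].
Proof.
elim: l O gO es => [|t l IH] O gO es les.
  move=> _; exists O, gO, id, id, [::]; split=> // [|fs]; first exact: embedding_id.
  by rewrite map_id cats0.
move=> [tM fl]; have [_ cM] := schedule_trace gO les.1.
have [A AC Ak] := choose_tokens cM tM.
rewrite (free_linearization les) in AC.
have lE fs : linearization fs -> linearization _ := @linearization_ext O t A fs AC.
have [|O' [gO' [f [g [ns [fg tns lns]]]]]] := IH _ (good_ext gO AC Ak) _ (lE _ les).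
  by rewrite trace_ext -cats1 run_cat.
exists O', gO', (f \o inl), (g \o Some), ((g None : {classic evs O'}) :: ns); split.
- exact: embedding_comp fg (embedding_ext t AC).
- by rewrite /= tns (emb_elab fg).
- move=> fs lfs; have := lns _ (lE _ lfs).
  by rewrite map_rcons cat_rcons -map_comp.
Qed.

(** When the marking covers both presets, disjoint token sets [A] and [B] can be chosen. Neither new
    event then depends on the other, and both orders linearize the same structure. *)
Lemma linearization_swap O (gO : good O) (es : seq {classic evs O}) (t u : {classic trans N}) :
  linearization es ->
  (forall s, pre_t t s + pre_t u s <= run (@init N) (trace es) s) ->
  exists O' (gO' : good O') (fs fs' : seq {classic evs O'}),
  [/\ linearization fs, linearization fs', trace fs = trace es ++ [:: t; u]
    & trace fs' = trace es ++ [:: u; t]].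
Proof.
move=> les tu; have [_ cM] := schedule_trace gO les.1.
rewrite (free_linearization les) in cM.
have [A AC Ak] : exists2 A, A `<=` [set p : pls O | con p = None]
    & forall s, (A `&` [set p | plab p = s] #= `I_(pre_t t s))%card.
  by apply: choose_tokens cM _ => s; exact: leq_trans (leq_addr _ _) (tu s).
have cMA s : (([set p : pls O | con p = None] `\` A) `&` [set p | plab p = s]
    #= `I_(run (@init N) (trace es) s - pre_t t s))%card.
  have [|_] := card_setD_II _ (cM s) (Ak s); first by move=> p [/AC].
  congr (_ #= _)%card; apply/seteqP; split=> p /= [].
    by move=> [pn ps] npA; split=> //; split=> // pA; apply: npA.
  by move=> [pn npA] ps; split=> // -[].
have [B BC Bk] : exists2 B, B `<=` [set p : pls O | con p = None] `\` A
    & forall s, (B `&` [set p | plab p = s] #= `I_(pre_t u s))%card.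
  by apply: choose_tokens cMA _ => s; have := tu s; lia.
have BN p : B p -> con p = None by move=> /BC[].
pose O1 := ext t A; have gO1 : good O1 := good_ext gO AC Ak.
pose B1 : set (pls O1) := inl @` B.
have B1N p : B1 p -> con p = None.
  by move=> [q /BC[/= qN qA] <-] /=; rewrite memNset // qN.
have B1k s : (B1 `&` [set p | plab p = s] #= `I_(flow_st s u))%card.
  have := Bk s; rewrite -(card_image_II (f := @inl _ (new_pls t))); last by move=> ? ? [].
  congr (_ #= _)%card; apply/seteqP; split=> [_ [p [Bp <-] <-]|_ [[p Bp <-] ps]].
    by split=> //; exists p.
  by exists p.
pose O2 := ext u B1; pose esA : seq {classic evs O1} := map Some es.
pose esAu : seq {classic evs O2} := rcons (map Some esA) None.
pose esAt : seq {classic evs O1} := rcons esA None.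
pose et : {classic evs O2} := Some None.
exists O2, (good_ext gO1 B1N B1k), (rcons (map Some esAt) None), (rcons esAu et).
have lA : linearization esAt := linearization_ext t AC les.
have l2 : linearization (_ : seq {classic evs O2}) := linearization_ext u B1N lA.
split=> //; last 2 first.
- by rewrite trace_ext trace_ext -!cats1 -catA.
- rewrite /trace map_rcons -/(trace esAu) /esAu trace_ext -!cats1 -catA.
  by rewrite (trace_map _ (embedding_ext t AC)).
have sAu : schedule esAu.
  apply: (@schedule_ext N O1 u B1 esA); first exact: schedule_ext_old les.1.
  move=> _ [p /BC[/= pN pA] <-]; split=> /= [a|e]; last first.
    by rewrite memNset // pN.
  case: (org p) => //= a' [<-].
  by apply: (map_f (T1 := {classic evs O}) (T2 := {classic evs O1})); exact: les.2.
have memE e : (e \in rcons esAu et) = (e \in (rcons (map Some esAt) None : seq {classic evs O2})).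
  by rewrite /esAt map_rcons !mem_rcons !inE !mem_rcons !inE orbCA.
split=> [|e]; last by rewrite memE; exact: l2.2.
have := schedule_uniq l2.1; rewrite /esAt map_rcons => u2.
apply: schedule_snoc => //.
  rewrite /esAu mem_rcons inE negb_or; apply/andP; split; first exact/eqP.
  by move: u2; rewrite rcons_uniq rcons_uniq => /andP[_ /andP[]].
move=> p a pa pe; have ae : a <> et.
  move=> ae; move: pe; rewrite -ae.
  by have [r rP] := good_rank (good_ext gO1 B1N B1k) => /(rP _ _ _ pa); rewrite ltnn.
have := l2.2 a; rewrite -memE mem_rcons inE => /orP[/eqP|//].
by move=> /ae.
Qed.

(** Outer induction on a bound for the ranks of [us], inner induction on the list: the finitely many
    producers needed by an event have smaller rank and are scheduled first. *)
Lemma schedule_extend O (gO : good O) (us es : seq {classic evs O}) : schedule es ->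
  exists2 fs, schedule (es ++ fs) & {subset us <= es ++ fs}.
Proof.
have [r rP] := good_rank gO; have [n] := ubnPleq (\max_(u <- us) (r u).+1).
move=> /bigmax_leqP_seq usn.
have {usn} : forall u, u \in us -> r u < n by move=> u uus; exact: usn.
elim: n us es => [|n IHn] us es usn ses.
  exists [::]; first by rewrite cats0.
  by move=> u /usn.
elim: us usn => [|u us IH] usn; first by exists [::]; rewrite ?cats0.
have [|fs sfs fsP] := IH; first by move=> v vus; apply: usn; rewrite inE vus orbT.
have [vs vsP] : exists vs : seq {classic evs O},
    forall p a, org p = Some a -> con p = Some u -> (a : {classic evs O}) \in vs.
  have /(@finite_seqP {classic pls O})[ps psP] := finite_pre gO u.
  pose og (p : {classic pls O}) : option {classic evs O} := org p.
  exists (pmap og ps) => p a pa pu; rewrite mem_pmap -[Some a]pa.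
  apply: (map_f og).
  by have : [set p | con p = Some u] p by []; rewrite psP.
(* [vs] is only known to contain the producers; the filter imposes the rank bound without losing any
   of them. *)
have [|gs sgs gsP] := IHn [seq v <- vs | r v < n] (es ++ fs) _ sfs.
  by move=> v; rewrite mem_filter => /andP[].
rewrite -catA in sgs gsP.
have sub v : v \in us -> v \in es ++ (fs ++ gs).
  by move=> /fsP vfs; rewrite catA mem_cat vfs.
have [ues|ues] := boolP (u \in es ++ (fs ++ gs)).
  by exists (fs ++ gs) => // v; rewrite inE => /orP[/eqP ->|/sub].
exists (rcons (fs ++ gs) u) => [|v]; last first.
  rewrite inE -rcons_cat mem_rcons inE => /orP[->//|/sub ->]; exact: orbT.
rewrite -rcons_cat; apply: schedule_snoc => // p a pa pu.
apply: gsP; rewrite mem_filter (vsP p a pa pu) andbT.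
by have := rP _ _ _ pa pu; have := usn u (mem_head _ _); lia.
Qed.

Lemma finite_linearization O (gO : good O) : finite_set [set: evs O] ->
  exists es : seq {classic evs O}, linearization es.
Proof.
move=> /(@finite_seqP {classic evs O})[us usP].
have [es ses esP] := schedule_extend gO us (schedule_nil O).
exists es; split=> // e; apply: esP.
by have : [set: evs O] e by []; rewrite usP.
Qed.

End Linearizations.


(** * Swapping *)

Section Swapping.
Variable N : net.
Implicit Types O : ostruct N.

Definition with_con O (c : pls O -> option (evs O)) : ostruct N :=
  @OStruct N (pls O) (evs O) (@org N O) c (@plab N O) (@elab N O).

Definition ranked O (r : evs O -> nat) :=
  forall p a b, org p = Some a -> con p = Some b -> r a < r b.

(** Every event causally after [p] has rank at least [r k], whereas [q] is initial or produced by an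
    event ranked below [k]. *)
Lemma not_flow_plus O r (gO : good O) (p q : pls O) k : ranked r ->
  (forall e, con p = Some e -> r k <= r e) ->
  (forall a, org q = Some a -> r a < r k) ->
  ~ @flow_plus (proc_of gO) (inl p) (inl q).
Proof.
move=> rr pk qk /clos_trans_t1n_iff pq.
have [e pe eq] : exists2 e, con p = Some e &
    @flow_plus (proc_of gO) (inr e) (inl q).
  inversion pq as [y py|y z py yq]; first by [].
  case: y py yq => // e; rewrite /= lt0b.
  by move=> /asboolP pe yq; exists e => //; exact/clos_trans_t1n_iff.
have := flow_plus_rank rr eq; have := pk e pe; rewrite /=.
by case qa : (org q) => [a|] //; have := qk a qa; lia.
Qed.

(** Swapping [p] with itself changes nothing and is permitted by acyclicity, so an isomorphism
    counts as a step once some place exists. *)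
Lemma isomorphic_swap_step (P Q : process N) (p : place P) :
  isomorphic P Q -> swap_step P Q.
Proof.
move=> PQ; exists p, p; split.
  by split=> //; exact: (proc_acyclic (processP P)).
case: PQ => f [g [fg st ts ini lab]]; exists f, g; split=> // s t /=.
rewrite st; case: ifPn => [/set_mem -> //|_].
by case: ifPn => [/set_mem -> //|].
Qed.

(* [c] is aligned with [c'] at the earliest event where they differ: the two
   places exchanged there are produced before that event and consumed not before
   it, so they are causally unrelated. *)
Lemma con_swap_equiv O (c c' : pls O -> option (evs O))
    (g : good (with_con c)) (g' : good (with_con c')) (r : evs O -> nat) :
  injective r -> @ranked (with_con c) r -> @ranked (with_con c') r ->
  finite_set [set: evs O] ->
  swap_equiv (proc_of g) (proc_of g').
Proof.
move=> rI + rc' evf.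
have /finite_setP[n] : finite_set [set p | c p <> c' p].
  apply: (@sub_finite_set _ _ (\bigcup_(e in [set: evs O])
      ([set p | c p = Some e] `|` [set p | c' p = Some e]))).
    move=> p /=; case cp : (c p) => [a|]; first by exists a => //; left.
    by case c'p : (c' p) => [a|] // _; exists a => //; right.
  apply: bigcup_finite => // e _; rewrite finite_setU.
  by split; [exact: (finite_pre g) | exact: (finite_pre g')].
(* Induction on the number of places with differing consumers: each exchange settles [q] and spoils
   no place that agreed. *)
elim/ltn_ind: n c g => n IH c g Dn rc.
have [/eqP D0|/set0P[x Dx]] := boolP ([set p | c p <> c' p] == set0).
  have cc' : c = c'.
    apply/funext => p; apply: contrapT => cp.
    by have : [set p | c p <> c' p] p by []; rewrite D0.
  by subst c'; rewrite (Prop_irrelevance g' g); exact: rt_refl.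
pose touched e := exists2 p, c p <> c' p & c p = Some e \/ c' p = Some e.
have [k [kt kmin]] : exists k, touched k /\ forall j, touched j -> r k <= r j.
  have [k0 k0t] : exists k, touched k.
    case cx : (c x) => [a|]; first by exists a, x => //; left.
    by case c'x : (c' x) => [a|]; [exists a, x => //; right | rewrite /= cx c'x in Dx].
  have [m] := ubnP (r k0); elim: m k0 k0t => // m IHm k0 k0t k0m.
  have [[j jt jk]|no] := pselect (exists2 j, touched j & r j < r k0).
    by apply: IHm jt _; exact: leq_trans jk k0m.
  by exists k0; split=> // j jt; rewrite leqNgt; apply/negP => jk; apply: no; exists j.
have later p j : c p <> c' p -> c p = Some j \/ c' p = Some j -> j <> k -> r k < r j.
  move=> Dp pj jk; rewrite ltn_neqAle kmin ?andbT; last by exists p.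
  by apply/eqP => /rI /esym.
(* With each label [k] has equally many preplaces under both assignments, so a place lost by [k] is
   made up for by another with the same label. *)
have exch (d d' : pls O -> option (evs O)) p (gd : good (with_con d)) (gd' : good (with_con d')) :
    d p = Some k -> d' p <> Some k ->
    exists q, [/\ d' q = Some k, d q <> Some k & plab q = plab p].
  move=> dp d'p; apply: contrapT => no; apply: d'p.
  have sub : [set q | d' q = Some k /\ plab q = plab p]
      `<=` [set q | d q = Some k /\ plab q = plab p].
    move=> q [/= d'q qp]; split=> //.
    by apply: contrapT => dq; apply: no; exists q.
  have E := card_sub_eq sub (good_pre gd' k (plab p)) (good_pre gd k (plab p)).
  have : [set q | d q = Some k /\ plab q = plab p] p by [].
  by rewrite -E => -[].
have [p [q [cp c'p c'q cq pq]]] : exists p q, [/\ c p = Some k, c' p <> Some k,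
    c' q = Some k, c q <> Some k & plab p = plab q].
  have [p Dp [pk|pk]] := kt.
    have c'p : c' p <> Some k by rewrite -pk => /esym.
    by have [q [? ? ?]] := exch c c' p g g' pk c'p; exists p, q.
  have cp : c p <> Some k by rewrite -pk.
  by have [q [? ? ?]] := exch c' c p g' g pk cp; exists q, p.
pose tau x := if x \in [set p] then q else if x \in [set q] then p else x.
have pqN : p <> q by move=> pq'; apply: cq; rewrite -pq'.
have tau_p : tau p = q by rewrite /tau mem_set.
have tau_q : tau q = p by rewrite /tau memNset ?mem_set // => /esym.
have tau_x y : y <> p -> y <> q -> tau y = y by move=> yp yq; rewrite /tau !memNset.
have tauK : involutive tau.
  move=> y; have [->|yp] := pselect (y = p); first by rewrite tau_p.
  have [->|yq] := pselect (y = q); first by rewrite tau_q.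
  by rewrite !tau_x.
have tau_lab y : plab (tau y) = plab y.
  by rewrite /tau; case: ifPn => [/set_mem ->|_] //; case: ifPn => [/set_mem ->|].
(* Minimality of [k] puts any consumer of [q] under [c] after [k]; [p] and [q] are produced before
   [k], each being its preplace under one assignment. *)
have lateq j : c q = Some j -> r k < r j.
  move=> qj; apply: (later q) => [|| jk]; [by rewrite c'q | by left | by rewrite -jk in cq].
have rq a : org q = Some a -> r a < r k by move=> qa; exact: (rc' q).
have rp a : org p = Some a -> r a < r k by move=> pa; exact: (rc p).
pose c2 y := c (tau y).
have r2 : @ranked (with_con c2) r.
  move=> y a b /= ya; rewrite /c2.
  have [yp|yp] := pselect (y = p).
    rewrite yp tau_p => /lateq; apply: ltn_trans; apply: rp; by rewrite -yp.
  have [yq|yq] := pselect (y = q).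
    by rewrite yq tau_q cp => -[<-]; apply: rq; rewrite -yq.
  by rewrite tau_x //; exact: (rc y).
have g2 : good (with_con c2).
  split; [exact: (good_init g) | exact: (good_post g) | move=> e s | by exists r].
  have := good_pre g e s; rewrite -(card_image_II (f := tau)); last exact: inv_inj.
  congr (_ #= _)%card; apply/seteqP; split=> [_ [y [/= ye ys] <-]|y [/= ye ys]].
    by split; rewrite /= ?tau_lab // /c2 tauK.
  by exists (tau y); rewrite ?tauK //; split; rewrite /= ?tau_lab.
apply: (@rt_trans _ _ _ (proc_of g2)).
  apply: rt_step; exists p, q; split.
    split=> //; apply: (@not_flow_plus (with_con c) r _ _ _ k rc) => //.
      by move=> e; rewrite /= cp => -[<-].
    by move=> e /lateq /ltnW.
  exists id, id; split=> //; first by split; exact: (Bijective (g := id)).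
  move=> y e /=; rewrite /c2 /tau; case: ifPn => // _; by case: ifPn.
have qD : [set q] `<=` [set y | c y <> c' y] by move=> _ -> /=; rewrite c'q.
have [n0 Dq] := card_setD_II qD Dn card_set1.
have [|m mn D2] := card_sub_II _ Dq (A := [set y | c2 y <> c' y]).
  move=> y /=; rewrite /c2; have [->|yq] := pselect (y = q).
    by rewrite tau_q cp c'q.
  have [->|yp] := pselect (y = p); first by rewrite cp => _; split=> // /esym.
  by rewrite tau_x.
by apply: (IH m _ c2 g2 D2 r2); lia.
Qed.

Lemma schedule_index O (es : seq {classic evs O}) : schedule es ->
  forall p (a b : {classic evs O}), org p = Some a -> con p = Some b ->
  b \in es -> index a es < index b es.
Proof.
elim=> // {}es f ses IH fes fP p a b pa pb; rewrite mem_rcons inE.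
rewrite -cats1 !index_cat => /orP[/eqP bf|bes].
  have aes := fP _ _ pa (etrans pb (congr1 Some bf)).
  by rewrite bf (negPf fes) aes ltn_addr // index_mem.
by rewrite bes (schedule_closed ses pa pb bes); exact: IH pa pb bes.
Qed.

(** A linearization lists each event exactly once, so events can be matched by position; equal
    traces make the matching preserve transitions. *)
Lemma index_bijection O O' (es : seq {classic evs O}) (es' : seq {classic evs O'}) :
  linearization es -> linearization es' -> trace es = trace es' ->
  exists2 h : evs O -> evs O', bijective h
    & forall e : {classic evs O}, index (h e : {classic evs O'}) es' = index e es
        /\ elab (h e) = elab e.
Proof.
move=> [ses esP] [ses' esP'] tr.
have sz : size es = size es' by have := congr1 size tr; rewrite !size_map.
have fib (P : ostruct N) (l : seq {classic evs P}) i : uniq l -> (forall e, e \in l) ->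
    ((fun e : {classic evs P} => index e l) @^-1` [set i] #= `I_(i < size l))%card.
  move=> ul lP; have [il|il] := ltnP i (size l).
    case: l il ul lP => // e0 l il ul lP; set l1 := e0 :: l.
    rewrite (_ : _ @^-1` _ = [set nth e0 l1 i]) ?card_set1 //.
    apply/seteqP; split=> [e /= <-|_ ->]; first by rewrite nth_index.
    exact: index_uniq.
  rewrite II0 card_eq0; apply/eqP; rewrite -subset0 => e /= ei.
  by move: il; rewrite -ei leqNgt index_mem lP.
have [h hb hE] : exists2 h : evs O -> evs O', bijective h
    & forall e : {classic evs O}, index (h e : {classic evs O'}) es' = index e es.
  apply: (@fiber_bijection (evs O) (evs O') nat
    (fun e : {classic evs O} => index e es)
    (fun e : {classic evs O'} => index e es')) => i; exists (i < size es); rewrite {2}sz.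
  by split; apply: fib => //; exact: schedule_uniq.
exists h => // e; split=> //.
have ie : index e es < size es by rewrite index_mem.
have := congr1 (nth (elab e) ^~ (index e es)) tr.
rewrite /trace (nth_map e) // (nth_map (h e : {classic evs O'})) -?sz //.
by rewrite -{2}hE !nth_index.
Qed.

(** With events matched by position and places by producer and label, only the consumers can differ.
    They are carried back to [O] as [c2] and aligned by [con_swap_equiv]; an isomorphism then leads
    to [O'], with [s0] providing the place it needs. *)
Lemma trace_swap_equiv O O' (g : good O) (g' : good O')
    (es : seq {classic evs O}) (es' : seq {classic evs O'}) s0 :
  0 < @init N s0 -> linearization es -> linearization es' -> trace es = trace es' ->
  swap_equiv (proc_of g) (proc_of g').
Proof.
move=> s0P les les' tr.
have [h hb hE] := index_bijection les les' tr.
have [h' hK h'K] := hb; have hI := can_inj hK.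
pose lab (p : pls O) := (omap h (org p), plab p).
pose lab' (p : pls O') := (org p, plab p).
have [f fb fE] : exists2 f : pls O -> pls O', bijective f & forall p, lab' (f p) = lab p.
  apply: fiber_bijection => -[[e'|] s].
    exists (flow_ts (elab e') s); split.
      have := good_post g (h' e') s; rewrite -(proj2 (hE _)) h'K.
      congr (_ #= _)%card; apply/seteqP; split=> p; rewrite /lab /=.
        by move=> [-> ->]; rewrite /= h'K.
      by case: (org p) => //= a [<- <-]; rewrite hK.
    have := good_post g' e' s.
    by congr (_ #= _)%card; apply/seteqP; split=> p; rewrite /lab' /= => -[-> ->].
  exists (init s); split.
    have := good_init g s.
    congr (_ #= _)%card; apply/seteqP; split=> p; rewrite /lab /=.
      by move=> [-> ->].
    by case: (org p) => //= -[].
  have := good_init g' s.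
  by congr (_ #= _)%card; apply/seteqP; split=> p; rewrite /lab' /= => -[-> ->].
have f_org p : org (f p) = omap h (org p) by case: (fE p).
have f_lab p : plab (f p) = plab p by case: (fE p).
have fI := bij_inj fb.
pose c2 p := omap h' (con (f p)).
have c2E p e : c2 p = Some e <-> con (f p) = Some (h e).
  rewrite /c2; case: (con _) => [a|] //=; split=> [[<-]|[->]]; first by rewrite h'K.
  by rewrite hK.
pose r (e : evs O) := index (e : {classic evs O}) es.
have rI : injective r.
  move=> a b ab; have := congr1 (nth (a : {classic evs O}) es) ab.
  by rewrite /r !nth_index //; exact: les.2.
have rO : @ranked (with_con (@con N O)) r.
  by move=> p a b pa pb; apply: (schedule_index les.1 pa pb); exact: les.2.
have r2 : @ranked (with_con c2) r.
  move=> p a b /= pa /c2E pb; rewrite /r -(proj1 (hE a)) -(proj1 (hE b)).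
  by apply: (schedule_index les'.1 (p := f p)); rewrite ?f_org ?pa //; exact: les'.2.
have gO : good (with_con (@con N O)) by case: g => *; split.
have g2 : good (with_con c2).
  split; [exact: (good_init g) | exact: (good_post g) | move=> e s | by exists r].
  rewrite -(card_image_II (f := f)) //=; have := good_pre g' (h e) s; rewrite (proj2 (hE e)).
  congr (_ #= _)%card; apply/seteqP; split=> [q [qe qs]|_ [p [/c2E pe ps] <-]].
    have [f' _ f'K] := fb; exists (f' q); last exact: f'K.
    by split; [apply/c2E; rewrite f'K | rewrite -f_lab f'K].
  by split=> //; rewrite f_lab.
have evf : finite_set [set: evs O].
  apply/(@finite_seqP {classic evs O}); exists es; apply/seteqP; split=> e //= _.
  exact: les.2.
have -> : proc_of g = proc_of gO.
  by case: (O) g gO => *; congr proc_of; exact: Prop_irrelevance.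
apply: rt_trans (con_swap_equiv gO g2 rI rO r2 evf) _.
have [p0 _] := (card_gt0_II (good_init g s0)).1 s0P.
apply: rt_step; apply: (@isomorphic_swap_step (proc_of g2) _ p0).
exists f, h; split=> //=.
- move=> p e; congr nat_of_bool; apply: asbool_equiv_eq; rewrite -c2E //.
- move=> e p; congr nat_of_bool; apply: asbool_equiv_eq; rewrite f_org.
  by split=> [|-> //]; case: (org p) => //= a [/hI ->].
- move=> p; congr nat_of_bool; apply: asbool_equiv_eq; rewrite f_org.
  by case: (org p).
- by split=> // e; have [] := hE e.
Qed.

(** [O] only supplies initial places: its restriction to no events has the empty linearization,
    which is then extended by [l]. *)
Lemma linearization_exists O (gO : good O) l : firable (@init N) l ->
  exists O' (gO' : good O') (es : seq {classic evs O'}),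
  linearization es /\ trace es = l.
Proof.
move=> fl; have s0 := schedule_nil O.
have [rs [srs rsE rsP]] := schedule_restr s0.
have rs0 : rs = [::] by case: rs rsE {srs rsP}.
subst rs; have l0 : linearization ([::] : seq {classic evs (@restr N O [::])}).
  by split; [exact: srs | exact: rsP].
have [O' [gO' [f [g [ns [_ tns lns]]]]]] := linearization_extend (good_restr gO s0) l0 fl.
by exists O', gO', ns; split=> //; exact: lns l0.
Qed.

(** The prefix [m] absorbs the common first transition in the congruence case. In the exchange case
    a structure carrying both orders, extended by the common rest, shares a trace with either
    side. *)
Lemma sim_swap_equiv s0 m l k : 0 < @init N s0 -> sim (run (@init N) m) l k ->
  firable (@init N) (m ++ l) ->
  forall O O' (g : good O) (g' : good O') (es : seq {classic evs O})
    (es' : seq {classic evs O'}),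
  linearization es -> linearization es' -> trace es = m ++ l -> trace es' = m ++ k ->
  swap_equiv (proc_of g) (proc_of g').
Proof.
move=> s0P; move ME: (run _ m) => M H.
elim: H m ME => {M l k} [M l|M l k n lk IH1 _ IH2|M t l k _ IH|M t u l tu] m ME fl
    O O' g g' es es' les les' tr tr'.
- by apply: trace_swap_equiv s0P les les' _; rewrite tr.
- have fk : firable (@init N) (m ++ k).
    have /firable_cat[fm fl'] := fl; apply/firable_cat; split=> //.
    by rewrite ME; apply: (proj1 (sim_run lk _)); rewrite -ME.
  have [O1 [g1 [es1 [les1 tr1]]]] := linearization_exists g fk.
  by apply: (@rt_trans _ _ _ (proc_of g1)); [apply: (IH1 m) tr tr1 | apply: (IH2 m) tr1 tr'].
- rewrite -!cat_rcons in tr tr' fl; apply: (IH (rcons m t)) tr tr' => //.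
  by rewrite -cats1 run_cat ME.
- have [fm fl'] := (firable_cat _ _ _).1 fl.
  have [O1 [g1 [es1 [les1 tr1]]]] := linearization_exists g fm.
  have [|O2 [g2 [f2 [f2' [lf lf' trf trf']]]]] := @linearization_swap _ _ g1 es1 t u les1.
    by rewrite tr1 ME.
  have fl2 : firable (run (@init N) (trace f2)) l.
    have := (firable_cat (@init N) (m ++ [:: t; u]) l).1.
    by rewrite -catA => /(_ fl)[_]; rewrite trf tr1.
  have [O3 [g3 [f3 [e3 [ns [fg trn lns]]]]]] := linearization_extend g2 lf fl2.
  apply: (@rt_trans _ _ _ (proc_of g3)).
    apply: trace_swap_equiv s0P les (lns _ lf) _.
    by rewrite trace_cat (trace_map _ fg) trf tr1 trn tr -catA.
  apply: trace_swap_equiv s0P (lns _ lf') les' _.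
  by rewrite trace_cat (trace_map _ fg) trf' tr1 trn tr' -catA.
Qed.

End Swapping.


Lemma split_first (T : eqType) (x : T) (l : seq T) : x \in l ->
  exists l1 l2, l = l1 ++ x :: l2 /\ x \notin l1.
Proof.
elim: l => // y l IH; rewrite inE; have [<- _|xy /=] := eqVneq x y.
  by exists [::], l.
move=> /IH[l1 [l2 [-> xl1]]]; exists (y :: l1), l2.
by rewrite inE negb_or xy.
Qed.

(** * Maximal processes *)

Section Coverage.
Variable N : net.
Implicit Types O : ostruct N.

Lemma sim_sym (M : mset (place N)) l k : sim M l k -> sim M k l.
Proof.
elim=> {M l k} [M l|M l k n _ lk _ kn|M t l k _|M t u l tu].
- exact: sim_refl.
- exact: sim_trans kn lk.
- exact: sim_cons.
- by apply: sim_swap => s; rewrite addnC.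
Qed.

Lemma maximal_stuck O (gO : good O) (t : trans N) (A : set (pls O)) :
  maximal_process (proc_of gO) -> (forall p, A p -> con p = None) ->
  ~ (forall s, (A `&` [set p | plab p = s] #= `I_(flow_st s t))%card).
Proof.
move=> mO AN Ak; apply: mO; exists (proc_of (good_ext gO AN Ak)), inl, Some; split.
  by apply: embedding_inclusion; exact: embedding_ext.
by move=> [_ /seteqP[_ /(_ None I)[]]].
Qed.

Hypothesis pers : persistent N.

(** Suppose [t] never occurs after [es]. By maximality some token chosen for [t] is consumed by an
    event [u], and [t] remains enabled up to [u]. Then [t] and the different transition [elab u] are
    enabled together and share a preplace, against persistence. *)
Lemma maximal_fires O (gO : good O) (es : seq {classic evs O}) (t : {classic trans N}) :
  maximal_process (proc_of gO) -> schedule es -> en (run (@init N) (trace es)) t ->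
  exists (fs : seq {classic evs O}) (e : {classic evs O}),
    [/\ schedule (es ++ rcons fs e), elab e = t & t \notin trace fs].
Proof.
move=> mO ses et; apply: contrapT => no.
have notr fs : schedule (es ++ fs) -> t \notin trace fs.
  elim/last_ind: fs => // fs e IH sfs.
  have sfs' : schedule (es ++ fs) by move: sfs; rewrite -rcons_cat => /schedule_rcons[].
  rewrite /trace map_rcons mem_rcons inE negb_or IH // andbT.
  by apply/eqP => te; apply: no; exists fs, e; split=> //; exact: IH.
have [_ cM] := schedule_trace gO ses.
have [A AC Ak] := choose_tokens cM et.
apply: (maximal_stuck mO _ Ak) => p Ap; case pu : (con p) => [u|] //; exfalso.
have [_ ues] := AC p Ap.
have [fs sfs /(_ u (mem_head _ _))] := schedule_extend gO [:: u] ses.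
rewrite mem_cat (negPf (ues u pu)) => /split_first[f1 [f2 [fE _]]].
move: sfs; rewrite fE -cat_rcons catA => /schedule_cat sfs.
move: (sfs); rewrite -rcons_cat => /schedule_rcons[sf1 _ _].
have [fl _] := schedule_trace gO sfs; have [fl1 _] := schedule_trace gO sf1.
move: fl; rewrite -rcons_cat /trace map_rcons -cats1 => /firable_cat[_ [Mu _]].
rewrite -/(trace (es ++ f1)) trace_cat in Mu fl1.
have [Mt _] := delay pers fl1 et (notr _ sf1).
have tu : t <> elab u.
  move=> tu; have := notr _ sfs; rewrite /trace map_rcons mem_rcons inE tu.
  by rewrite eqxx.
have [t0|u0] := pers fl1 Mt Mu tu (plab p).
  have := (card_gt0_II (Ak (plab p))).2; rewrite -/(pre_t t (plab p)) t0.
  by move=> /(_ (ex_intro _ p (conj Ap erefl))).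
have := (card_gt0_II (good_pre gO u (plab p))).2; rewrite -/(pre_t _ (plab p)) u0.
by move=> /(_ (ex_intro _ p (conj pu erefl))).
Qed.

(** The sequence [k] collects what the process fires beyond [l]. For a further transition [t]: if
    [t] occurs in [k], its first occurrence is moved to the front of [k]; otherwise [t] is still
    enabled, occurs later in the maximal process, and is moved forward over everything in
    between. *)
Lemma maximal_covers O (gO : good O) (l : seq {classic trans N}) :
  maximal_process (proc_of gO) -> firable (@init N) l ->
  exists (es : seq {classic evs O}) (k : seq {classic trans N}),
    schedule es /\ sim (@init N) (trace es) (l ++ k).
Proof.
move=> mO; elim/last_ind: l => [|l t IH].
  by move=> _; exists [::], [::]; split; [exact: schedule_nil | exact: sim_refl].
rewrite -cats1 => /firable_cat[fl [lt _]].
have [es [k [ses esk]]] := IH fl.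
have [fes _] := schedule_trace gO ses.
have [flk runE] := sim_run esk fes.
have [tk|tk] := boolP (t \in k).
  have [k1 [k2 [kE tk1]]] := split_first tk.
  have flk1 : firable (@init N) (l ++ k1).
    by move: flk; rewrite kE catA => /firable_cat[].
  have [_ tk'] := delay pers flk1 lt tk1.
  exists es, (k1 ++ k2); split=> //; apply: sim_trans esk _.
  rewrite kE -cat_rcons -catA; apply: sim_cat.
  exact: (@sim_catr _ _ _ (t :: k1)).
have [kt tk'] := delay pers flk lt tk.
rewrite -runE in kt.
have [fs [e [sfs et tfs]]] := maximal_fires mO ses kt.
have ff : firable (@init N) (trace es ++ trace fs).
  rewrite -trace_cat; apply: (proj1 (schedule_trace gO _)).
  by move: sfs; rewrite -rcons_cat => /schedule_rcons[].
have [_ ft] := delay pers ff kt tfs.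
exists (es ++ rcons fs e), (k ++ trace fs); split=> //.
rewrite trace_cat /trace map_rcons et -!/(trace _).
apply: sim_trans (sim_cat ft) _.
apply: sim_trans (sim_catr _ esk) _.
rewrite -!catA; apply: sim_cat.
by rewrite -cat_rcons; exact: (@sim_catr _ _ _ (t :: k)).
Qed.

(* [swap_step] needs a place to swap, so without places even isomorphic processes
   need not be [swap_equiv]; a net without initial tokens is treated apart. *)
Lemma no_tokens O (gO : good O) : (forall s, @init N s = 0) ->
  (pls O -> False) /\ (evs O -> False).
Proof.
move=> i0; have [r rP] := good_rank gO.
have org_neq p : org p <> None :> option (evs O).
  move=> p0; have := (card_gt0_II (good_init gO (plab p))).2; rewrite i0.
  by move=> /(_ (ex_intro _ p (conj p0 erefl))).
have evF : evs O -> False.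
  move=> e; have [n] := ubnP (r e); elim: n e => // n IH e en.
  have [p pe] := pre_nonempty gO e; case pa : (org p) => [a|]; last exact: org_neq pa.
  by apply: (IH a); exact: leq_trans (rP _ _ _ pa pe) en.
by split=> // p; case pa : (org p) => [a|]; [exact: evF a | exact: org_neq pa].
Qed.

(** The right-hand side does not depend on [Q]. When there are initial tokens, a finite [P] extended
    by the surplus [k] and the prefix of [Q] given by [es] have traces related by [sim], hence are
    swapping equivalent. *)
Lemma maximal_BD (Q : process N) : maximal_process Q ->
  BD Q = [set swap_class P | P in [set P : process N | finite_process P]].
Proof.
move=> mQ; apply/seteqP; split=> [C [D _ [P' [_ [finP' _ -> _ _]]]]|C [P finP <-]].
  by exists P'.
have [OQ [gQ EQ]] := processE Q; subst Q.
have [OP [gP EP]] := processE P; subst P.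
have [s0|i0] := pselect (exists s0, 0 < @init N s0); last first.
  have {}i0 s : @init N s = 0.
    by apply/eqP; rewrite -leqn0 leqNgt; apply/negP => s0; apply: i0; exists s.
  have [[pP eP] [pQ eQ]] := (no_tokens gP i0, no_tokens gQ i0).
  have finQ : finite_process (proc_of gQ).
    by rewrite /finite_process (_ : setT = set0) // -subset0 => e _; exact: eQ e.
  exists (swap_class (proc_of gQ)); first exists (proc_of gQ) => //.
    split=> //; exists id, id; apply: (@embedding_inclusion _ _ _ gQ gQ).
    exact: embedding_id.
  exists (proc_of gP), (proc_of gQ); split=> //.
  exists (proc_of gP), (proc_of gQ); split; [exact: rt_refl | | exact: rt_refl].
  exists (fun p => False_rect _ (pP p)), (fun e => False_rect _ (eP e)).
  apply: embedding_inclusion.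
  by split=> [p|e|p|p|p|p|e]; case: (pP p) || case: (eP e) || case: (pQ p).
have {s0} [s0 s0P] := s0.
have [ps lps] := finite_linearization gP finP.
have [fps _] := schedule_trace gP lps.1.
have [es [k [ses esk]]] := maximal_covers mQ fps.
have [fes _] := schedule_trace gQ ses.
have [fpk _] := sim_run esk fes.
have [rs [srs rsE rsP]] := schedule_restr ses.
pose Q0 := proc_of (good_restr gQ ses).
have fQ0 : finite_process Q0 := finite_restr ses.
exists (swap_class Q0); first exists Q0 => //.
  split=> //; exists val, val; apply: embedding_inclusion; exact: embedding_restr.
exists (proc_of gP), Q0; split=> //.
have [_ fk] := (firable_cat _ _ _).1 fpk.
have [O2 [g2 [f [g [ns [fg tns lns]]]]]] := linearization_extend gP lps fk.
exists (proc_of gP), (proc_of g2); split; first exact: rt_refl.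
  by exists f, g; exact: embedding_inclusion.
apply: (@sim_swap_equiv _ s0 [::] (trace ps ++ k) (trace es) s0P (sim_sym esk) fpk
  _ _ _ _ _ rs (lns _ lps)) => //.
  by rewrite trace_cat (trace_map _ fg) tns.
by have := trace_map rs (embedding_restr es); rewrite rsE => ->.
Qed.

End Coverage.


(** * Existence of a maximal process *)

Lemma finite_argmax (T : eqType) (f : T -> nat) (l : seq T) (x0 : T) : x0 \in l ->
  exists2 x, x \in l & forall y, y \in l -> f y <= f x.
Proof.
elim: l x0 => // a l IH x0 _; case: l IH => [|b l] IH.
  by exists a; rewrite ?mem_head // => y; rewrite inE => /eqP ->.
have [x xl xmax] := IH b (mem_head _ _).
have [ax|xa] := leqP (f a) (f x).
  by exists x => [|y]; rewrite inE ?xl ?orbT // => /orP[/eqP -> //|/xmax].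
exists a => [|y]; first exact: mem_head.
rewrite inE => /orP[/eqP -> //|/xmax yx]; exact: leq_trans yx (ltnW xa).
Qed.

Lemma asbool_nat_eq (P Q : Prop) : (`[<P>] : nat) = `[<Q>] -> (P <-> Q).
Proof. by case: (asboolP P) => p; case: (asboolP Q) => q. Qed.

Section Existence.
Variable N : net.

(** A proper extension contains a new event, for a new place is neither initial nor produced by an
    old event. The preplaces of a new event of least rank all lie in the range of [f] and are
    unconsumed in [O], which [stuck] forbids. *)
Lemma stuck_maximal (O : ostruct N) (gO : good O) :
  (forall (t : trans N) (A : set (pls O)), (forall p, A p -> con p = None) ->
    ~ (forall s, (A `&` [set p | plab p = s] #= `I_(flow_st s t))%card)) ->
  maximal_process (proc_of gO).
Proof.
move=> stuck [Q [f [g [inc nsurj]]]]; have [O' [g' EQ]] := processE Q; subst Q.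
have conE p e : con (f p) = Some (g e) <-> con p = Some e.
  exact: asbool_nat_eq (incl_flow_st inc p e).
have orgE p e : org (f p) = Some (g e) <-> org p = Some e.
  exact: asbool_nat_eq (incl_flow_ts inc e p).
have org0 q : org q = None -> range f q.
  by move=> q0; apply: contrapT => /(incl_init0 inc) /=; rewrite asboolT.
have fI : injective f := incl_inj_s inc.
have labE p : @plab N O' (f p) = plab p := incl_pi_s inc p.
(* The postplaces of [e] within the range are already as many, for each label, as the arc weights
   allow. *)
have orgS q e : org q = Some (g e) -> range f q.
  move=> qe; have := good_post gO e (plab q); rewrite -(card_image_II _ _ fI).
  have -> : elab e = elab (g e) by exact/esym/(incl_pi_t inc e).
  have sub : f @` [set p | org p = Some e /\ plab p = plab q]
      `<=` [set p | org p = Some (g e) /\ plab p = plab q].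
    by move=> _ [p [/orgE pe pq] <-]; split=> //; rewrite labE.
  move=> Pn; have E := card_sub_eq sub Pn (good_post g' (g e) (plab q)).
  have : [set p | org p = Some (g e) /\ plab p = plab q] q by [].
  by rewrite -E => -[p _ <-]; exists p.
have [r rP] := good_rank g'.
have [u [ug umin]] : exists u, ~ range g u /\ forall v, r v < r u -> range g v.
  have [u0 u0g] : exists u, ~ range g u.
    apply: contrapT => no; have gT u : range g u.
      by apply: contrapT => ug; apply: no; exists u.
    apply: nsurj; split; apply/seteqP; split=> // x _ //.
    case xo : (@org N O' x) => [a|]; last exact: org0.
    by have [e _ ea] := gT a; apply: (orgS _ e); rewrite ea.
  have [n] := ubnP (r u0); elim: n u0 u0g => // n IH u0 u0g u0n.
  have [[v [vg vu]]|no] := pselect (exists v, ~ range g v /\ r v < r u0).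
    by apply: (IH v vg); exact: leq_trans vu u0n.
  exists u0; split=> // v vu; apply: contrapT => vg; apply: no; by exists v.
apply: (stuck (elab u) [set p | con (f p) = Some u]) => [p /= pu|s].
  case pe : (con p) => [e|] //; move/conE: pe; rewrite pu => -[ue].
  by case: ug; exists e.
rewrite -(card_image_II _ _ fI); have := good_pre g' u s; congr (_ #= _)%card.
apply/seteqP; split=> [q [/= qu qs]|_ [p [/= pu ps] <-]]; last by rewrite /= labE.
have [p _ pq] : range f q.
  case qa : (org q) => [a|]; last exact: org0.
  by have [e _ ea] := umin a (rP _ _ _ qa qu); apply: (orgS _ e); rewrite ea.
by exists p => //; split; rewrite /= -?labE pq.
Qed.

(* Names for the nodes of a process: an event is the pair (t, p) of its label and
   a preplace p of maximal depth, and TPost s i t p is the i-th place labelled s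
   that it produces.  A relation R between such names says which event consumes
   which place; the events present are those consuming their own name. *)
Inductive tok :=
| TInit of place N & nat
| TPost of place N & nat & trans N & tok.

Fixpoint depth (p : tok) := if p is TPost _ _ _ q then (depth q).+1 else 0.

Definition tok_lab (p : tok) := match p with TInit s _ => s | TPost s _ _ _ => s end.

Implicit Types (R : set (tok * (trans N * tok))).

Definition present R (p : tok) : Prop := match p with
  | TInit s i => i < init s
  | TPost s i t q => i < flow_ts t s /\ R (q, (t, q)) end.

(** [coh_name] makes the name of an event one of its own preplaces and a deepest one, so that
    [depth] can serve as a rank. *)
Record coherent R : Prop := Coherent {
  coh_fun : forall p e e', R (p, e) -> R (p, e') -> e = e';
  coh_present : forall p e, R (p, e) -> present R p;
  coh_name : forall q t p, R (q, (t, p)) -> R (p, (t, p)) /\ depth q <= depth p;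
  coh_card : forall t p s, R (p, (t, p)) ->
    ([set q | R (q, (t, p)) /\ tok_lab q = s] #= `I_(flow_st s t))%card }.

Lemma present_mono R R' p : R `<=` R' -> present R p -> present R' p.
Proof. by move=> RR'; case: p => //= s i t q [? /RR']. Qed.

(** Chain condition for Zorn's lemma. The clause to watch is [coh_card]: a larger member of the
    chain cannot give an event already present more preplaces, as the counts agree. *)
Lemma coherent_bigcup (F : set (set (tok * (trans N * tok)))) :
  F `<=` coherent -> total_on F subset -> coherent (\bigcup_(X in F) X).
Proof.
move=> Fc Ft; split.
- move=> p e e' [R1 F1 R1p] [R2 F2 R2p].
  have [R12|R21] := Ft _ _ F1 F2.
    exact: (coh_fun (Fc _ F2) (R12 _ R1p) R2p).
  exact: (coh_fun (Fc _ F1) R1p (R21 _ R2p)).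
- move=> p e [R FR Rp]; apply: (@present_mono R); first exact: bigcup_sup.
  exact: coh_present (Fc _ FR) _ _ Rp.
- move=> q t p [R FR Rq]; have [Rp qp] := coh_name (Fc _ FR) Rq.
  by split=> //; exists R.
- move=> t p s [R FR Rp].
  have := coh_card (Fc _ FR) s Rp; congr (_ #= _)%card.
  apply/seteqP; split=> q /=; first by move=> [Rq <-]; split=> //; exists R.
  move=> [[R2 F2 R2q] qs]; split=> //.
  have [R12|R21] := Ft _ _ FR F2; last exact: R21.
  have [R2p _] := coh_name (Fc _ F2) R2q.
  have sub : [set q | R (q, (t, p)) /\ tok_lab q = s]
      `<=` [set q | R2 (q, (t, p)) /\ tok_lab q = s] by move=> x [/= /R12].
  have E := card_sub_eq sub (coh_card (Fc _ FR) s Rp) (coh_card (Fc _ F2) s R2p).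
  have : [set q | R2 (q, (t, p)) /\ tok_lab q = s] q by [].
  by rewrite -E => -[].
Qed.

Section FromRelation.
Variable (R : set (tok * (trans N * tok))) (cR : coherent R).

Definition rel_con (p : tok) : option (trans N * tok) :=
  if pselect (exists e, R (p, e)) is left h then Some (projT1 (cid h)) else None.

Lemma rel_conP p e : rel_con p = Some e <-> R (p, e).
Proof.
rewrite /rel_con; case: pselect => [h|no]; last by split=> // Rp; case: no; exists e.
case: (cid h) => e' /= Re'; split=> [[<-] //|Re].
by rewrite (coh_fun cR Re' Re).
Qed.

Definition rel_struct : ostruct N := @OStruct N
  {p : tok | `[< present R p >]} {e : trans N * tok | `[< R (e.2, e) >]}
  (fun p => if val p is TPost s i t q then insub (t, q) else None)
  (fun p => obind insub (rel_con (val p)))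
  (fun p => tok_lab (val p)) (fun e => (val e).1).

Lemma rel_struct_con (p : pls rel_struct) (e : evs rel_struct) :
  con p = Some e <-> R (val p, val e).
Proof.
rewrite -rel_conP /=; case pe : (rel_con (val p)) => [[t q]|] //=.
have [/rel_conP Rp] := pe; have [Rq _] := coh_name cR Rp.
rewrite insubT /=; first exact/asboolP.
move=> h; split=> [[<-] //|[E]]; congr Some; exact: val_inj.
Qed.

Lemma rel_struct_org (p : pls rel_struct) :
  omap val (org p) = if val p is TPost s i t q then Some (t, q) else None.
Proof.
case: p => -[s i|s i t q] h //=; rewrite insubT //=.
by apply/asboolP; move/asboolP: h => [].
Qed.

Lemma good_rel_struct : good rel_struct.
Proof.
have orgE (p : pls rel_struct) e : org p = Some e <-> omap val (org p) = Some (val e).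
  by case: (@org N rel_struct p) => [a|] //=; split=> [[->] //|[/val_inj ->]].
have org0 (p : pls rel_struct) : org p = None <-> omap val (org p) = None.
  by case: (@org N rel_struct p) => [a|].
split.
- move=> s; rewrite -(card_image_II (f := val)) /=; last exact: val_inj.
  rewrite (_ : _ @` _ = TInit s @` `I_(init s)).
    by apply: (card_eq_trans (inj_card_eq _) (card_eqxx _)) => i j _ _ [].
  apply/seteqP; split=> [_ [p [/org0 + ps] <-]|_ [i ini <-]].
    rewrite rel_struct_org; case: p ps => -[s' i|s' i t q] h //= s's _.
    by exists i; [move/asboolP: h; rewrite /= s's | rewrite -s's].
  have h : `[< present R (TInit s i) >] by apply/asboolP.
  by exists (exist _ (TInit s i) h : pls rel_struct).
- move=> e s; rewrite -(card_image_II (f := val)) /=; last exact: val_inj.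
  rewrite (_ : _ @` _ = (fun i => TPost s i (val e).1 (val e).2) @` `I_(flow_ts (val e).1 s)).
    by apply: (card_eq_trans (inj_card_eq _) (card_eqxx _)) => i j _ _ [].
  apply/seteqP; split=> [_ [p [/orgE + ps] <-]|_ [i ini <-]].
    rewrite rel_struct_org; case: p ps => -[s' i|s' i t q] h //= s's [<-] /=.
    by exists i; [move/asboolP: h => [] /=; rewrite s's | rewrite -s's].
  have h : `[< present R (TPost s i (val e).1 (val e).2) >].
    apply/asboolP; split=> //; have := asboolW (valP e).
    by case: (val e).
  pose x : pls rel_struct := exist _ (TPost s i (val e).1 (val e).2) h.
  exists x => //; split=> //; apply: (proj2 (orgE x e)).
  by rewrite rel_struct_org /= -surjective_pairing.
- move=> e s; rewrite -(card_image_II (f := val)) /=; last exact: val_inj.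
  case: e => -[t p] h; have Rp := asboolW h; have := coh_card cR s Rp.
  congr (_ #= _)%card; apply/seteqP; split=> [q [Rq qs]|_ [q [/rel_struct_con Rq qs] <-]] //.
  have hq : `[< present R q >] by apply/asboolP; exact: coh_present cR _ _ Rq.
  exists (exist _ q hq : pls rel_struct) => //; split=> //.
  exact/rel_struct_con.
(* A place produced by [a] lies one deeper than the name of [a], and no deeper than the name of its
   consumer [b]. *)
- exists (fun e => depth (val e).2) => p a b /orgE pa /rel_struct_con pb.
  rewrite rel_struct_org in pa.
  have := pb; rewrite (surjective_pairing (val b)) => /(coh_name cR)[_].
  apply: leq_trans; case: (val p) pa => // s i t q [pa].
  by rewrite (_ : \val a = (t, q)) /= ?ltnSn.
Qed.

(** If [t] could still consume [A], adding the pairs that let the event named by [t] and a deepest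
    place [p0] of [A] consume [A] would give a larger coherent relation. *)
Lemma rel_struct_maximal : (forall R', R `<` R' -> ~ coherent R') ->
  maximal_process (proc_of good_rel_struct).
Proof.
move=> Rmax; apply: stuck_maximal => t A AN Ak.
have [l lA] := finite_choice Ak.
have [_ [s0 s0t] _] := netP t.
have [p0' [Ap0' _]] := (card_gt0_II (Ak s0)).1 s0t.
have p0l : (p0' : {classic pls rel_struct}) \in l by move: Ap0'; rewrite lA.
have [p0 + p0max] := finite_argmax (fun p : {classic pls rel_struct} => depth (val p)) p0l.
move=> p0l'; have Ap0 : A p0 by rewrite lA.
have unused p x e : A p -> val p = x -> ~ R (x, e).
  move=> /AN pn <- Rp; have h : `[< R (e.2, e) >].
    apply/asboolP; move: Rp; rewrite (surjective_pairing e) => /(coh_name cR)[].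
    by [].
  by have /rel_struct_con := (Rp : R (val p, val (exist _ e h : evs rel_struct))); rewrite pn.
pose R' := R `|` [set x | x.2 = (t, val p0) /\ exists2 p, A p & val p = x.1].
have RR' : R `<=` R' by move=> x Rx; left.
apply: (Rmax R').
  split=> // R'R; apply: (unused p0 _ (t, val p0) Ap0 erefl).
  by apply: R'R; right; split=> //; exists p0.
(* The name is fresh: an event bearing it would consume [p0], which is unconsumed in [R]. *)
have nR q : ~ R (q, (t, val p0)) by move=> /(coh_name cR)[/(unused _ _ _ Ap0 erefl)].
split.
- move=> p e e' [Rp|[/= -> [q Aq qp]]] [Rp'|[/= e'E [q' Aq' qp']]].
  + exact: (coh_fun cR Rp Rp').
  + by case: (unused q' _ e Aq' qp').
  + by case: (unused q _ e' Aq qp).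
  + by rewrite e'E.
- move=> p e [Rp|[_ [q _ /= <-]]]; apply: present_mono RR' _.
    exact: coh_present cR _ _ Rp.
  exact: asboolW (valP q).
- move=> q t' p [Rq|[/= [-> ->] [q' Aq' <-]]].
    by have [? ?] := coh_name cR Rq; split=> //; exact: RR'.
  split; first by right; split=> //; exists p0.
  by apply: p0max; move: Aq'; rewrite lA.
- move=> t' p s [Rp|[/= [-> ->] _]].
    have := coh_card cR s Rp; congr (_ #= _)%card.
    apply/seteqP; split=> q [/= Rq qs]; split=> //; first by left.
    case: Rq => // -[/= [tt' pp0] _]; exfalso; move: Rp; rewrite tt' pp0.
    exact: nR.
  have := Ak s; rewrite -(card_image_II _ _ val_inj); congr (_ #= _)%card.
  apply/seteqP; split=> [_ [q [Aq qs] <-]|q [/= [/nR //|[_ [q' Aq' /= q'q]]] qs]].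
    by split=> //; right; split=> //; exists q.
  by subst q; exists q'.
Qed.

End FromRelation.

Lemma maximal_process_exists : exists P : process N, maximal_process P.
Proof.
have [R [cR Rmax]] := Zorn_bigcup coherent_bigcup.
by exists (proc_of (good_rel_struct cR)); exact: rel_struct_maximal.
Qed.

End Existence.

Theorem theorem5 (N : net) (hcf : conflict_free N)
    (hscn : structural_conflict_net N) :
  exists! B : set (process N), BD_process B /\ weakly_maximal B.
Proof.
have pers := persistent_cf_scn hcf hscn.
have [P mP] := maximal_process_exists N.
exists (inf_class P); split.
  by split; [exists P | exists P].
move=> B [[P' ->] [P'' P''P' mP'']].
(* [P''] is a maximal member of the class of [P'], and [BD] takes the same value at all maximal
   processes. *)
have EB : BD P = BD P'.
  by rewrite (P''P' : BD P' = BD P'') !maximal_BD.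
by rewrite /inf_class /swap_equiv_inf EB.
Qed.
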